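(* Let $h,n$ be integers with $3\le h\le n-1$. The graph $K^{h}_{n}$ is determined by its $D$-spectrum: every connected graph whose distance matrix has the same spectrum as $D(K^{h}_{n})$ is isomorphic to $K^{h}_{n}$.
   Context: All graphs are simple, undirected and connected. For a connected graph $G$ with vertices $v_1,\dots,v_n$, the distance matrix is $D(G)=(d_{ij})$, where $d_{ij}$ is the distance between $v_i$ and $v_j$; its eigenvalues form the distance spectrum ($D$-spectrum) of $G$. Two graphs are $D$-cospectral if they have the same distance spectrum, and $G$ is determined by its $D$-spectrum if every graph $D$-cospectral to $G$ is isomorphic to $G$. $K^{h}_{n}$ denotes the graph on $n$ vertices obtained from the complete graph $K_h$ by attaching $n-h$ pendant edges to one vertex of $K_h$. *)

(* Defs.v *)
From mathcomp Require Import all_boot all_order all_algebra.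
From mathcomp Require Import algC.
Set Implicit Arguments. Unset Strict Implicit. Unset Printing Implicit Defensive.
Import Order.TTheory GRing.Theory Num.Theory.

Definition simple_graph (n : nat) (e : rel 'I_n) : Prop :=
  irreflexive e /\ symmetric e.

Definition connected_graph (n : nat) (e : rel 'I_n) : Prop :=
  forall x y : 'I_n, connect e x y.

Fixpoint walk_le (n : nat) (e : rel 'I_n) (k : nat) (x y : 'I_n) : bool :=
  match k with
  | 0 => x == y
  | k'.+1 => walk_le e k' x y || [exists z, e x z && walk_le e k' z y]
  end.

(* Graph distance: the least k such that a walk of length <= k exists
   (searched in 0..n-1, which suffices for connected graphs). *)
Definition gdist (n : nat) (e : rel 'I_n) (x y : 'I_n) : nat :=
  find (fun k => walk_le e k x y) (iota 0 n).

(* Distance matrix, with entries in algC (the eigenvalues live there). *)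
Definition dist_mx (n : nat) (e : rel 'I_n) : 'M[algC]_n :=
  \matrix_(i, j) ((gdist e i j)%:R)%R.

(* D-cospectral: same distance spectrum, i.e. same characteristic polynomial
   of the distance matrices (roots with multiplicity = the spectrum).
   Equality in {poly algC} also forces equal numbers of vertices. *)
Definition D_cospectral (m n : nat) (e : rel 'I_m) (e' : rel 'I_n) : Prop :=
  char_poly (dist_mx e) = char_poly (dist_mx e').

Definition graph_iso (m n : nat) (e : rel 'I_m) (e' : rel 'I_n) : Prop :=
  exists f : 'I_m -> 'I_n, bijective f /\ forall x y, e' (f x) (f y) = e x y.

Definition Kpend (h n : nat) : rel 'I_n :=
  fun x y => (x != y) &&
    [|| (x < h) && (y < h),
        (val x == 0) && (h <= y) | (val y == 0) && (h <= x)].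
Arguments Kpend h n : clear implicits.

(* Main.v *)
Require Import Defs.
From mathcomp Require Import all_boot all_order all_algebra.
From mathcomp Require Import algC.
From mathcomp Require Import fingroup perm zify ring.
Set Implicit Arguments. Unset Strict Implicit. Unset Printing Implicit Defensive.
Import Order.TTheory GRing.Theory Num.Theory.

(* K^h_n is a cone over a clique Q of size a = h - 1 plus b = n - h isolated
   vertices, and completing squares in its distance form shows that its
   distance matrix has only one eigenvalue above -1/2, only two above -1 and
   only one below -2. A D-cospectral graph G has a unitarily similar distance
   matrix, so no distance submatrix of G can violate these bounds. Finitely
   many small distance tables are excluded in this way, by integer vectors that
   are orthogonal for the form.
   - If G has diameter at least 3, then, apart from one graph on five vertices,
     it consists of two cliques joined by an edge. If b = 1 the sum of the
     squared distances is too large, and if b > 1 then -2 is an eigenvalue of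
     K^h_n but not of G.
   - If G has diameter 2, then it is a cone over a disjoint union of cliques.
     The traces of the second and third powers of the distance matrix then give
     the sums of the degrees and of their squares, which force all cliques but
     one to be single vertices. *)

(** * Graph distance *)

Lemma walk_leW n (e : rel 'I_n) j k x y : j <= k -> walk_le e j x y -> walk_le e k x y.
Proof.
move=> /subnK <-; elim: (k - j) => [//|i IH] /IH; rewrite addSn /= => ->.
by [].
Qed.

Lemma walk_le_cat n (e : rel 'I_n) j k x y z :
  walk_le e j x y -> walk_le e k y z -> walk_le e (j + k) x z.
Proof.
elim: j x => [|j IH] x /=; first by move/eqP->.
case/orP=> [xy yz|/existsP[u /andP[xu uy]] yz]; first by rewrite IH.
by apply/orP; right; apply/existsP; exists u; rewrite xu IH.
Qed.

Lemma walk_le_sym n (e : rel 'I_n) k x y :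
  symmetric e -> walk_le e k x y -> walk_le e k y x.
Proof.
move=> eC; elim: k x y => [|k IH] x y; first by rewrite /= eq_sym.
case/orP=> [/IH/(walk_leW (leqnSn k))//|/existsP[u /andP[xu /IH yu]]].
rewrite -addn1; apply: walk_le_cat yu _ => /=.
by apply/orP; right; apply/existsP; exists x; rewrite eC xu eqxx.
Qed.

Lemma walk_le_path n (e : rel 'I_n) x p : path e x p -> walk_le e (size p) x (last x p).
Proof.
elim: p x => //= y p IH x /andP[xy /IH w].
by apply/orP; right; apply/existsP; exists y; rewrite xy.
Qed.

(** Removing repetitions from a connecting path leaves fewer than [n] edges, so the search in
    [gdist] succeeds within [iota 0 n]; its minimality and [walk_leW] then give the equivalence. *)
Lemma gdist_leE n (e : rel 'I_n) k x y :
  connected_graph e -> (gdist e x y <= k) = walk_le e k x y.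
Proof.
move=> /(_ x y)/connectP[p0 p0p ->]; case/shortenP: p0p => p ep up _.
have sp : size p < n by have := card_uniqP up; have := max_card [in x :: p]; rewrite card_ord /= => ? <-.
set P := fun k => walk_le e k x (last x p).
have hasP : has P (iota 0 n).
  by apply/hasP; exists (size p); [rewrite mem_iota | apply: walk_le_path].
have lt_dn : gdist e x (last x p) < n by rewrite -[X in _ < X](size_iota 0 n) -has_find.
have Pd : walk_le e (gdist e x (last x p)) x (last x p).
  by have := nth_find 0 hasP; rewrite nth_iota.
apply/idP/idP => [/walk_leW|]; first by apply.
case: leqP => // lt_kd wk; have := before_find 0 lt_kd.
by rewrite nth_iota ?add0n ?wk // (ltn_trans lt_kd).
Qed.

Definition connected_simple n (e : rel 'I_n) := simple_graph e /\ connected_graph e.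

Lemma gdist_eq0 n (e : rel 'I_n) x y :
  connected_simple e -> (gdist e x y == 0) = (x == y).
Proof. by move=> [_ ce]; rewrite -leqn0 gdist_leE. Qed.

Lemma gdistxx n (e : rel 'I_n) x : connected_simple e -> gdist e x x = 0.
Proof. by move=> ge; apply/eqP; rewrite gdist_eq0. Qed.

Lemma gdistC n (e : rel 'I_n) x y : connected_simple e -> gdist e x y = gdist e y x.
Proof.
move=> [[_ eC] ce]; apply/eqP; rewrite eqn_leq !gdist_leE //.
by apply/andP; split; apply: (walk_le_sym eC); rewrite -gdist_leE.
Qed.

Lemma gdist_triangle n (e : rel 'I_n) x y z :
  connected_simple e -> gdist e x z <= gdist e x y + gdist e y z.
Proof.
by move=> [_ ce]; rewrite gdist_leE //; apply: (walk_le_cat (y := y)); rewrite -gdist_leE.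
Qed.

(** [z] is the first step of a shortest walk; were it closer than [k] to [y], then [x] would be
    closer than [k.+1]. *)
Lemma gdist_step n (e : rel 'I_n) k x y :
  connected_simple e -> gdist e x y = k.+1 -> exists2 z, e x z & gdist e z y = k.
Proof.
move=> [_ ce] d; have := leqnn k.+1; rewrite -{1}d gdist_leE //= -gdist_leE // d ltnn /=.
case/existsP => z /andP[xz]; rewrite -gdist_leE // => le_zy; exists z => //.
apply/eqP; rewrite eqn_leq le_zy /= -ltnS -d gdist_leE //.
have : walk_le e (gdist e z y) z y by rewrite -gdist_leE.
by move=> w; apply/orP; right; apply/existsP; exists z; rewrite xz.
Qed.

Lemma gdist_eq1 n (e : rel 'I_n) x y : connected_simple e -> (gdist e x y == 1) = e x y.
Proof.
move=> ge; apply/eqP/idP => [/(gdist_step ge)[z xz /eqP]|xy].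
  by rewrite gdist_eq0 // => /eqP <-.
have [[ei _] ce] := ge; apply/eqP; rewrite eqn_leq lt0n gdist_eq0 // gdist_leE //=.
apply/andP; split; last by apply: contraTneq xy => ->; rewrite ei.
by apply/orP; right; apply/existsP; exists y; rewrite xy eqxx.
Qed.

Lemma gdist_eq2 n (e : rel 'I_n) x y z : connected_simple e ->
  e x z -> e z y -> x != y -> ~~ e x y -> gdist e x y = 2.
Proof.
move=> ge xz zy; rewrite -(gdist_eq1 _ _ ge) -(gdist_eq0 _ _ ge).
have := gdist_triangle x z y ge.
move: xz zy; rewrite -!(gdist_eq1 _ _ ge) => /eqP -> /eqP ->.
by case: (gdist e x y) => [|[|[|]]].
Qed.

(** * Hermitian forms of distance matrices *)

Local Open Scope ring_scope.
Local Open Scope sesquilinear_scope.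

Lemma char_poly_conj (F : fieldType) n (P A : 'M[F]_n) :
  P \in unitmx -> char_poly (invmx P *m A *m P) = char_poly A.
Proof.
move=> uP; rewrite /char_poly /char_poly_mx.
set Q := map_mx polyC P; set Qi := map_mx polyC (invmx P).
have QiQ : Qi *m Q = 1%:M by rewrite -map_mxM mulVmx // map_mx1.
have -> : 'X%:M - map_mx polyC (invmx P *m A *m P)
          = Qi *m ('X%:M - map_mx polyC A) *m Q.
  rewrite mulmxBr mulmxBl !map_mxM; congr (_ - _).
  by rewrite scalar_mxC -mulmxA QiQ mulmx1.
by rewrite !det_mulmx mulrAC -det_mulmx QiQ det1 mul1r.
Qed.

Lemma perm_mx_unitary (n : nat) (s : 'S_n) : (perm_mx s : 'M[algC]_n) \is unitarymx.
Proof.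
apply/unitarymxP; rewrite tr_perm_mx map_perm_mx -perm_mxM mulgV.
exact: perm_mx1.
Qed.

(** Both matrices are unitarily diagonalizable, and equal characteristic polynomials make the two
    diagonals permutations of each other; [V] combines the two diagonalizations with that
    permutation matrix. *)
Lemma cospectral_unitary (n : nat) (A B : 'M[algC]_n) :
  A \is normalmx -> B \is normalmx -> char_poly A = char_poly B ->
  exists2 V : 'M[algC]_n, V \is unitarymx & A = V^t* *m B *m V.
Proof.
move=> nA nB eqAB.
have /orthomx_spectralP := nA; have /orthomx_spectralP := nB.
set P := spectralmx B; set Q := spectralmx A.
set b := spectral_diag B; set a := spectral_diag A => eB eA.
have uP : P \is unitarymx := spectral_unitarymx B.
have uQ : Q \is unitarymx := spectral_unitarymx A.
have cpd (d : 'rV[algC]_n) : char_poly (diag_mx d) = \prod_(x <- [tuple d 0 i | i < n]) ('X - x%:P).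
  rewrite char_poly_trig ?diag_mx_is_trig // big_map big_enum /=.
  by apply: eq_bigr => i _; rewrite mxE eqxx.
have : perm_eq [tuple a 0 i | i < n] [tuple b 0 i | i < n].
  apply: prod_XsubC_eq; rewrite -!cpd.
  by move: eqAB; rewrite eA eB !char_poly_conj ?unitarymx_unit.
case/tuple_permP => s /val_inj eqs.
have as_ i : a 0 i = b 0 (s i).
  by rewrite -[LHS](tnth_mktuple (fun i => a 0 i)) eqs !tnth_mktuple.
have ed : diag_mx a = perm_mx s *m diag_mx b *m (perm_mx s)^t*.
  rewrite tr_perm_mx map_perm_mx; apply/matrixP => i j.
  rewrite -row_permE [RHS]mxE (bigD1 (s j)) //= !mxE permK eqxx mulr1 big1 ?addr0.
    by rewrite -as_ (inj_eq perm_inj).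
  by move=> k kj; rewrite !mxE (canF_eq (permKV s)) (negbTE kj) mulr0.
exists (P^t* *m (perm_mx s)^t* *m Q).
  by rewrite !mul_unitarymx ?trmxC_unitary ?perm_mx_unitary.
rewrite {1}eA eB ed !invmx_unitary // !trmx_mul !map_mxM !trmxCK !mulmxA.
by rewrite !mulmxtVK.
Qed.

Definition herm (n : nat) (A : 'M[algC]_n) (x y : 'rV[algC]_n) : algC :=
  (x *m A *m y^t*) 0 0.

Lemma hermDl n (A : 'M[algC]_n) x x' y : herm A (x + x') y = herm A x y + herm A x' y.
Proof. by rewrite /herm !mulmxDl mxE. Qed.

Lemma hermZl n (A : 'M[algC]_n) a x y : herm A (a *: x) y = a * herm A x y.
Proof. by rewrite /herm -!scalemxAl mxE. Qed.

Lemma hermDr n (A : 'M[algC]_n) x y y' : herm A x (y + y') = herm A x y + herm A x y'.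
Proof. by rewrite /herm linearD map_mxD mulmxDr mxE. Qed.

Lemma herm0r n (A : 'M[algC]_n) x : herm A x 0 = 0.
Proof. by rewrite /herm trmx0 map_mx0 mulmx0 mxE. Qed.

Lemma herm0l n (A : 'M[algC]_n) y : herm A 0 y = 0.
Proof. by rewrite /herm !mul0mx mxE. Qed.

Lemma hermZr n (A : 'M[algC]_n) (a : int) x y :
  herm A x (a%:~R *: y) = a%:~R * herm A x y.
Proof.
rewrite /herm linearZ /= map_mxZ -scalemxAr mxE; congr (_ * _).
by apply/CrealP; rewrite realz.
Qed.

Lemma herm_delta n (A : 'M[algC]_n) i j : herm A (delta_mx 0 i) (delta_mx 0 j) = A i j.
Proof.
rewrite /herm -rowE trmx_delta map_delta_mx -colE !mxE.
by [].
Qed.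

Lemma herm_outer n (y x : 'rV[algC]_n) :
  y \is a realmx -> herm (y^T *m y) x x = `|(x *m y^T) 0 0| ^+ 2.
Proof.
move=> ry; rewrite /herm mulmxA -mulmxA normCK mxE big_ord1; congr (_ * _).
rewrite !mxE rmorph_sum; apply: eq_bigr => i _.
by rewrite !mxE rmorphM /= mulrC; congr (_ * _); apply/esym/CrealP/(mxOverP ry).
Qed.

Lemma herm_row p q n (A : 'M[algC]_n) (U : 'M_(p, n)) (U' : 'M_(q, n)) i j :
  (U *m A *m U'^t*) i j = herm A (row i U) (row j U').
Proof. by rewrite /herm -row_mul tr_row map_col !mxE; apply: eq_bigr => k _; rewrite !mxE. Qed.

Lemma herm_diag n (d x : 'rV[algC]_n) :
  herm (diag_mx d) x x = \sum_i d 0 i * `|x 0 i| ^+ 2.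
Proof.
rewrite /herm mxE; apply: eq_bigr => i _.
by rewrite mul_mx_diag !mxE normCK; ring.
Qed.

(* A Courant-Fischer bound: a Hermitian form that is nonpositive on a subspace
   of codimension [r] has no [r + 1] orthogonal vectors of positive square. *)
Lemma no_positive_orthogonal_family (n r : nat) (A V : 'M[algC]_n)
    (W : 'M[algC]_(n, r)) (U : 'M[algC]_(r.+1, n)) :
  V \is unitarymx ->
  (forall x, x *m W = 0 -> herm A x x <= 0) ->
  (forall i j, i != j -> herm (V^t* *m A *m V) (row i U) (row j U) = 0) ->
  ~ (forall i, 0 < herm (V^t* *m A *m V) (row i U) (row i U)).
Proof.
move=> uV negA orthU posU; set B := V^t* *m A *m V in orthU posU.
set M := U *m V^t* *m W.
have: kermx M != 0.
  by rewrite kermx_eq0 -row_leq_rank -ltnNge ltnS; exact: rank_leq_col.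
case/rowV0Pn => c /sub_kermxP cM0 c0.
have /negA : c *m U *m V^t* *m W = 0 by rewrite -cM0 /M !mulmxA.
pose g := \row_i herm B (row i U) (row i U).
(* The Gram matrix of an orthogonal family is diagonal, so the form at this combination is a sum of
   squares with positive weights. *)
have -> : herm A (c *m U *m V^t*) (c *m U *m V^t*) = herm (diag_mx g) c c.
  have <- : U *m B *m U^t* = diag_mx g.
    apply/matrixP => i j; rewrite herm_row !mxE.
    by case: eqVneq => [->|/orthU].
  by rewrite /herm !trmx_mul !map_mxM trmxCK /B !mulmxA.
apply/negP; rewrite herm_diag lt_geF //.
have [i ci] : exists i, c 0 i != 0 by apply/rV0Pn.
rewrite (bigD1 i) //= ltr_wpDr ?sumr_ge0 // => [j _|]; rewrite mxE.
  by rewrite mulr_ge0 ?exprn_ge0 // ltW.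
by rewrite mulr_gt0 // exprn_gt0 // normr_gt0.
Qed.

(* The rows [us] are integer coordinate vectors on a list of vertices whose
   strict upper triangle of distances is [M]; [f] turns distances into the
   entries of the form [s * (p * D + q)]. *)
Fixpoint dot (f : nat -> int) (d : seq nat) (w : seq int) : int :=
  if (d, w) is (k :: d', b :: w') then f k * b + dot f d' w' else 0.

Fixpoint tri_form (f : nat -> int) (M : seq (seq nat)) (u w : seq int) : int :=
  if (M, u, w) is (d :: M', a :: u', b :: w') then
    f 0%N * a * b + a * dot f d w' + b * dot f d u' + tri_form f M' u' w'
  else 0.

Definition positive_family (f : nat -> int) (M : seq (seq nat)) (us : seq (seq int)) :=
  all (fun i => all (fun j =>
    let b := tri_form f M (nth [::] us i) (nth [::] us j) in
    if i == j then (0 < b)%R else b == 0) (iota 0 (size us))) (iota 0 (size us)).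

Fixpoint distances (n : nat) (e : rel 'I_n) (vs : seq 'I_n) : seq (seq nat) :=
  if vs is v :: vs' then map (gdist e v) vs' :: distances e vs' else [::].

Fixpoint comb (n : nat) (vs : seq 'I_n) (u : seq int) : 'rV[algC]_n :=
  if (vs, u) is (v :: vs', a :: u') then
    a%:~R *: delta_mx 0 v + comb vs' u'
  else 0.

Definition entry_mx (f : nat -> int) (n : nat) (e : rel 'I_n) : 'M[algC]_n :=
  \matrix_(i, j) (f (gdist e i j))%:~R.

(** Reduces the Hermitian form on integer combinations of vertices to integer arithmetic on a
    distance table, which can be tested by evaluation. *)
Lemma herm_comb (f : nat -> int) n (e : rel 'I_n) vs u w :
  (forall x, gdist e x x = 0%N) -> (forall x y, gdist e x y = gdist e y x) ->
  herm (entry_mx f e) (comb vs u) (comb vs w) = (tri_form f (distances e vs) u w)%:~R.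
Proof.
move=> d0 dC.
have hl v vs' w' : herm (entry_mx f e) (delta_mx 0 v) (comb vs' w')
                   = (dot f (map (gdist e v) vs') w')%:~R.
  elim: vs' w' => [|v' vs' IH] [|b w'] /=; rewrite ?herm0r //.
  by rewrite hermDr hermZr herm_delta IH mxE intrD intrM mulrC.
have hr v vs' w' : herm (entry_mx f e) (comb vs' w') (delta_mx 0 v)
                   = (dot f (map (gdist e v) vs') w')%:~R.
  elim: vs' w' => [|v' vs' IH] [|b w'] /=; rewrite ?herm0l //.
  by rewrite hermDl hermZl herm_delta IH mxE intrD intrM mulrC dC.
elim: vs u w => [|v vs IH] [|a u] [|b w] //=; rewrite ?herm0l ?herm0r //.
rewrite hermDl !hermDr !hermZl !hermZr hl hr IH herm_delta mxE d0.
by rewrite !intrD !intrM; ring.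
Qed.

Lemma no_positive_family (f : nat -> int) n (e e' : rel 'I_n) (r : nat) (V : 'M_n)
    (W : 'M_(n, r)) vs us :
  (forall x, gdist e x x = 0%N) -> (forall x y, gdist e x y = gdist e y x) ->
  V \is unitarymx -> entry_mx f e = V^t* *m entry_mx f e' *m V ->
  (forall x, x *m W = 0 -> herm (entry_mx f e') x x <= 0) ->
  size us = r.+1 -> ~~ positive_family f (distances e vs) us.
Proof.
move=> d0 dC uV eV negW su; apply/negP => /allP pos.
pose U := \matrix_(i < r.+1) comb vs (nth [::] us i).
have us_i (i : 'I_r.+1) : (i : nat) \in iota 0 (size us) by rewrite mem_iota su /=.
have pij (i j : 'I_r.+1) : let b := tri_form f (distances e vs) (nth [::] us i) (nth [::] us j) in
    if i == j then (0 < b)%R else b == 0.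
  by have /allP /(_ _ (us_i j)) := pos _ (us_i i).
apply: (no_positive_orthogonal_family (U := U) uV negW) => [i j ij|i].
  have := pij i j; rewrite -eV !rowK herm_comb // (negbTE ij) => /eqP ->.
  by [].
by have := pij i i; rewrite -eV !rowK herm_comb // eqxx ltr0z.
Qed.

(** * The spectrum of a cone *)

(** Whether [v] belongs to [Q] is left open, which is why the indicators of the clique used below
    also test [i != v]. *)
Definition cone_rel (n : nat) (v : 'I_n) (Q : {set 'I_n}) : rel 'I_n :=
  fun x y => (x != y) && [|| x == v, y == v | (x \in Q) && (y \in Q)].

Lemma cone_connected_simple n (v : 'I_n) Q : connected_simple (cone_rel v Q).
Proof.
have ec : symmetric (cone_rel v Q).
  by move=> x y; rewrite /cone_rel eq_sym orbCA; case: (x \in Q); case: (y \in Q).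
have ev x : connect (cone_rel v Q) x v.
  case: (eqVneq x v) => [->|xv]; first exact: connect0.
  by apply: connect1; rewrite /cone_rel xv eqxx orbT.
split; first by split=> // x; rewrite /cone_rel eqxx.
by move=> x y; apply: connect_trans (ev x) _; rewrite (sym_connect_sym ec).
Qed.

Lemma gdist_cone n (v : 'I_n) Q x y : gdist (cone_rel v Q) x y =
  if x == y then 0%N else if [|| x == v, y == v | (x \in Q) && (y \in Q)] then 1%N else 2%N.
Proof.
have gc := cone_connected_simple v Q.
case: (eqVneq x y) => [->|xy]; first exact: gdistxx.
case: ifPn => [exy|nxy]; first by apply/eqP; rewrite gdist_eq1 // /cone_rel xy.
move: (nxy); rewrite !negb_or => /and3P[xv yv _].
by apply: (gdist_eq2 (z := v)); rewrite // /cone_rel ?xv ?xy // ?eqxx ?orbT // eq_sym yv.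
Qed.

Definition nat_row n (g : 'I_n -> nat) : 'rV[algC]_n := \row_i (g i)%:R.

Lemma herm_nat_row n (g : 'I_n -> nat) x :
  herm ((nat_row g)^T *m nat_row g) x x = `|(x *m (nat_row g)^T) 0 0| ^+ 2.
Proof. by apply: herm_outer; apply/mxOverP => i j; rewrite mxE realn. Qed.

Lemma herm_nat_row_eq0 n (g : 'I_n -> nat) x :
  x *m (nat_row g)^T = 0 -> herm ((nat_row g)^T *m nat_row g) x x = 0.
Proof. by rewrite herm_nat_row => ->; rewrite mxE normr0 expr0n. Qed.

Lemma herm_nat_diag_ge0 n (g : 'I_n -> nat) x : 0 <= herm (diag_mx (nat_row g)) x x.
Proof.
by rewrite herm_diag sumr_ge0 // => i _; rewrite mxE mulr_ge0 ?exprn_ge0 ?ler0n.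
Qed.

Lemma herm_addm n (A B : 'M[algC]_n) x y : herm (A + B) x y = herm A x y + herm B x y.
Proof. by rewrite /herm mulmxDr mulmxDl mxE. Qed.

Lemma herm_natm n (A : 'M[algC]_n) k x y : herm (A *+ k) x y = herm A x y *+ k.
Proof. by elim: k => [|k IH]; rewrite ?mulr0n ?mulrS ?herm_addm ?IH // /herm mulmx0 mul0mx mxE. Qed.

Lemma herm_oppm n (A : 'M[algC]_n) x y : herm (- A) x y = - herm A x y.
Proof. by rewrite /herm mulmxN mulNmx mxE. Qed.

(** The three forms are the entries of [D + 1], [2 D + 1] and [-(2 D + 4)]; their positive
    directions count the eigenvalues of [D] above -1, above -1/2 and below -2. *)
Definition form_1 (d : nat) : int := if d == 0%N then 1 else d%:Z.
Definition form_2 (d : nat) : int := if d == 0%N then 1 else (2 * d)%N%:Z.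
Definition form_3 (d : nat) : int := - (if d == 0%N then 4 else (2 * d)%N%:Z).

(* With [s] the indicator of [v]'s complement and [a] that of [Q], the forms
   [2 D + 1], [D + 1] and [2 D + 4] of the cone are
   [(1 + s)(1 + s)^T - 2 a a^T - diag], [1 1^T + s s^T - a a^T - diag] and
   [(2 - s)(2 - s)^T + 3 s s^T - 2 a a^T + diag] with nonnegative diagonals. *)
Lemma cone_form_2 n (v : 'I_n) (Q : {set 'I_n}) (x : 'rV_n) :
  x *m (nat_row (fun i => 1 + (i != v))%N)^T = 0 ->
  herm (entry_mx form_2 (cone_rel v Q)) x x <= 0.
Proof.
set w := fun i => _ => xw.
pose a i := nat_of_bool [&& i != v & i \in Q].
have -> : entry_mx form_2 (cone_rel v Q) =
   (nat_row w)^T *m nat_row w - ((nat_row a)^T *m nat_row a) *+ 2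
   - diag_mx (nat_row (fun i => if i == v then 0 else if i \in Q then 1 else 3)%N).
  apply/matrixP => i j; rewrite !mxE !big_ord1 !mxE gdist_cone /form_2 /w /a.
  case: (eqVneq i j) => [->|ij].
    by case: (j == v) => //=; case: (j \in Q); rewrite //= ?mulr1n; ring.
  case: (eqVneq i v) => [iv|iv]; case: (eqVneq j v) => [jv|jv] /=.
  - by rewrite iv jv eqxx in ij.
  - by ring.
  - by ring.
  by case: (i \in Q); case: (j \in Q) => //=; ring.
rewrite !herm_addm !herm_oppm herm_natm (herm_nat_row_eq0 xw) !herm_nat_row add0r.
by rewrite -opprD oppr_le0 addr_ge0 ?herm_nat_diag_ge0 // mulrn_wge0 // exprn_ge0.
Qed.

Lemma cone_form_3 n (v : 'I_n) (Q : {set 'I_n}) (x : 'rV_n) :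
  x *m (nat_row (fun i => [&& i != v & i \in Q] : nat))^T = 0 ->
  herm (entry_mx form_3 (cone_rel v Q)) x x <= 0.
Proof.
set a := fun i => _ => xa.
pose w i := (1 + (i == v))%N; pose s i := nat_of_bool (i != v).
have -> : entry_mx form_3 (cone_rel v Q) =
   - ((nat_row w)^T *m nat_row w) - ((nat_row s)^T *m nat_row s) *+ 3
   + ((nat_row a)^T *m nat_row a) *+ 2 - diag_mx (nat_row (fun i => 2 * a i)%N).
  apply/matrixP => i j; rewrite !mxE !big_ord1 !mxE gdist_cone /form_3 /w /a /s.
  case: (eqVneq i j) => [->|ij].
    by case: (j == v) => //=; case: (j \in Q); rewrite //= ?mulr1n; ring.
  case: (eqVneq i v) => [iv|iv]; case: (eqVneq j v) => [jv|jv] /=.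
  - by rewrite iv jv eqxx in ij.
  - by ring.
  - by ring.
  by case: (i \in Q); case: (j \in Q) => //=; ring.
rewrite !herm_addm !herm_oppm !herm_natm (herm_nat_row_eq0 xa) !herm_nat_row !addr0.
rewrite -!opprD oppr_le0 !addr_ge0 ?herm_nat_diag_ge0 // ?exprn_ge0 //.
Qed.

(** Two squares enter with a positive sign here, against one in the other forms; hence the two
    linear conditions, and witness families of three vectors instead of two. *)
Lemma cone_form_1 n (v : 'I_n) (Q : {set 'I_n}) (x : 'rV_n) :
  x *m (col_mx (nat_row (fun=> 1%N)) (nat_row (fun i => (i != v) : nat)))^T = 0 ->
  herm (entry_mx form_1 (cone_rel v Q)) x x <= 0.
Proof.
rewrite tr_col_mx mul_mx_row => /eqP; rewrite row_mx_eq0 => /andP[/eqP].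
set o := fun=> _; set s := fun i => _ => xo /eqP xs.
pose a i := nat_of_bool [&& i != v & i \in Q].
have -> : entry_mx form_1 (cone_rel v Q) =
   (nat_row o)^T *m nat_row o + (nat_row s)^T *m nat_row s
   - (nat_row a)^T *m nat_row a
   - diag_mx (nat_row (fun i => [&& i != v & i \notin Q] : nat)).
  apply/matrixP => i j; rewrite !mxE !big_ord1 !mxE gdist_cone /form_1 /o /a /s.
  case: (eqVneq i j) => [->|ij].
    by case: (j == v) => //=; case: (j \in Q); rewrite //= ?mulr1n; ring.
  case: (eqVneq i v) => [iv|iv]; case: (eqVneq j v) => [jv|jv] /=.
  - by rewrite iv jv eqxx in ij.
  - by ring.
  - by ring.
  by case: (i \in Q); case: (j \in Q) => //=; ring.
rewrite !herm_addm !herm_oppm (herm_nat_row_eq0 xo) (herm_nat_row_eq0 xs) !herm_nat_row !add0r.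
by rewrite -opprD oppr_le0 addr_ge0 ?herm_nat_diag_ge0 // exprn_ge0.
Qed.

(** * Transfer of spectral data from a cone to a cospectral graph *)

Lemma dist_mx_normal n (e : rel 'I_n) : connected_simple e -> dist_mx e \is normalmx.
Proof.
move=> ge; apply: symmetric_normalmx; last by apply/mxOverP => i j; rewrite mxE realn.
apply/is_hermitianmxP; rewrite expr0 scale1r map_mx_id //.
by apply/matrixP => i j; rewrite !mxE gdistC.
Qed.

Lemma entry_mx_affine (f : nat -> int) (p q : int) n (e : rel 'I_n) :
  connected_simple e -> (forall d, f d = if d == 0%N then q else p * d%:Z) ->
  entry_mx f e = p%:~R *: dist_mx e + q%:~R%:M.
Proof.
move=> ge ef; apply/matrixP => i j; rewrite !mxE ef gdist_eq0 //.
case: eqVneq => [->|_]; first by rewrite gdistxx // mulr0 add0r mulr1n.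
by rewrite mulr0n addr0 intrM.
Qed.

(** An affine function of the distance matrix is conjugated by the same [V], because scalar matrices
    are central. *)
Lemma entry_mx_conj (f : nat -> int) (p q : int) n (e e' : rel 'I_n) (V : 'M_n) :
  connected_simple e -> connected_simple e' -> V \is unitarymx ->
  dist_mx e = V^t* *m dist_mx e' *m V ->
  (forall d, f d = if d == 0%N then q else p * d%:Z) ->
  entry_mx f e = V^t* *m entry_mx f e' *m V.
Proof.
move=> ge ge' uV eD ef; rewrite !(entry_mx_affine _ ef) // eD.
rewrite mulmxDr mulmxDl -scalemxAr -scalemxAl; congr (_ + _).
by rewrite -invmx_unitary // scalar_mxC -mulmxA mulVmx ?mulmx1 ?unitarymx_unit.
Qed.

(* What cospectrality with a cone transfers to a graph: the position of all
   but three eigenvalues, in the form of forbidden distance configurations,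
   the second and third moments, and the eigenvalue [-2]. *)
Record cone_spectrum n (e : rel 'I_n) (v : 'I_n) (Q : {set 'I_n}) : Prop := ConeSpectrum {
  no_family_1 : forall vs us, size us = 3%N -> ~~ positive_family form_1 (distances e vs) us;
  no_family_2 : forall vs us, size us = 2%N -> ~~ positive_family form_2 (distances e vs) us;
  no_family_3 : forall vs us, size us = 2%N -> ~~ positive_family form_3 (distances e vs) us;
  moment2 : \tr (dist_mx e *m dist_mx e) =
            \tr (dist_mx (cone_rel v Q) *m dist_mx (cone_rel v Q));
  moment3 : \tr (dist_mx e *m dist_mx e *m dist_mx e) =
     \tr (dist_mx (cone_rel v Q) *m dist_mx (cone_rel v Q) *m dist_mx (cone_rel v Q));
  minus2 : forall p q, p != q -> p != v -> q != v -> p \notin Q -> q \notin Q ->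
     exists2 z : 'rV_n, z != 0 & z *m dist_mx e = (- 2) *: z }.

Lemma cospectral_cone_spectrum n (e : rel 'I_n) v Q :
  connected_simple e -> char_poly (dist_mx e) = char_poly (dist_mx (cone_rel v Q)) ->
  cone_spectrum e v Q.
Proof.
move=> ge eqc; have gc := cone_connected_simple v Q.
have [V uV eD] := cospectral_unitary (dist_mx_normal ge) (dist_mx_normal gc) eqc.
have VV : V *m V^t* = 1%:M by apply/unitarymxP.
have d0 x : gdist e x x = 0%N by apply: gdistxx.
have dC x y : gdist e x y = gdist e y x by apply: gdistC.
have eM2 : dist_mx e *m dist_mx e = V^t* *m (dist_mx (cone_rel v Q) *m dist_mx (cone_rel v Q)) *m V.
  by rewrite eD !mulmxA mulmxtVK.
split.
- move=> vs us; apply: (@no_positive_family form_1 n e (cone_rel v Q) 2 V _ vs us d0 dC uV _ (@cone_form_1 n v Q)).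
  apply: (entry_mx_conj (p := 1) (q := 1) ge gc uV eD) => d.
  by rewrite /form_1 mul1r.
- move=> vs us; apply: (@no_positive_family form_2 n e (cone_rel v Q) 1 V _ vs us d0 dC uV _ (@cone_form_2 n v Q)).
  apply: (entry_mx_conj (p := 2) (q := 1) ge gc uV eD) => d.
  by rewrite /form_2 PoszM.
- move=> vs us; apply: (@no_positive_family form_3 n e (cone_rel v Q) 1 V _ vs us d0 dC uV _ (@cone_form_3 n v Q)).
  apply: (entry_mx_conj (p := -2) (q := -4) ge gc uV eD) => d.
  by rewrite /form_3 PoszM; case: eqP => // _; rewrite mulNr.
- by rewrite eM2 mxtrace_mulC mulmxA VV mul1mx.
- rewrite eM2 {1}eD !mulmxA mulmxtVK // -!mulmxA mxtrace_mulC !mulmxA.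
  by rewrite -!mulmxA VV mulmx1 !mulmxA.
move=> p q pq pv qv pQ qQ.
(* The leaves [p] and [q] are at distance 2 from each other and have equal distances to every other
   vertex, so their difference is an eigenvector for -2. *)
pose y : 'rV[algC]_n := delta_mx 0 p - delta_mx 0 q.
have ey : y *m dist_mx (cone_rel v Q) = (- 2) *: y.
  apply/rowP => j; rewrite mulmxBl -!rowE !mxE !gdist_cone !eqxx /=.
  rewrite (negbTE pv) (negbTE qv) (negbTE pQ) (negbTE qQ) /= !orbF.
  case: (eqVneq p j) => [jp|pj]; case: (eqVneq q j) => [jq|qj] //=.
  - by rewrite jp jq eqxx in pq.
  - by rewrite -jp (negbTE pv); ring.
  - by rewrite -jq (negbTE qv); ring.
  by ring.
exists (y *m V).
  apply/negP => /eqP/(congr1 (mulmx^~ (V^t*))); rewrite mul0mx mulmxtVK //.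
  by move/rowP/(_ p)/eqP; rewrite !mxE !eqxx (negbTE pq) subr0 oner_eq0.
by rewrite eD !mulmxA -(mulmxA y) VV mulmx1 ey -scalemxAl.
Qed.

Local Close Scope sesquilinear_scope.
Local Close Scope ring_scope.

(** * Forbidden distance tables *)

(* Families found by computer search. *)
Definition witnesses_1 : seq (seq (seq int)) := [::
  [:: [:: 1; 0; 0; 0; 0]; [:: 2; -2; 2; -1; -1]; [:: 2; 0; -2; 1; -1]];
  [:: [:: 0; 0; 0; 1; 0]; [:: 0; 1; -2; 0; 0]; [:: 1; -1; -1; 1; -1]];
  [:: [:: 0; 0; 0; 1; 0]; [:: 0; 1; -2; 2; -2]; [:: 1; -2; 1; 2; -2]];
  [:: [:: 0; 0; 0; 0; 1]; [:: 0; 0; 2; -1; 0]; [:: 1; -2; -1; 0; 1]];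
  [:: [:: 0; 0; 0; 0; 0; 1]; [:: 0; 0; 0; 2; -1; 0]; [:: 0; 1; -2; 0; 0; 0]];
  [:: [:: 0; 0; 1; 0; 0; 0]; [:: 1; -1; 2; -1; -1; 0]; [:: 1; 0; -1; 1; -2; 1]];
  [:: [:: 0; 0; 1; 0; 0; 0]; [:: 1; -1; 2; -1; 0; -1]; [:: 1; 0; -1; 1; 1; -2]];
  [:: [:: 0; 0; 0; 0; 0; 1]; [:: 0; 2; -1; 0; 0; 0]; [:: 2; 0; 0; 0; -1; 0]];
  [:: [:: 0; 0; 0; 0; 0; 1]; [:: 0; 0; 0; 1; -2; 0]; [:: 0; 1; -2; 0; 0; 0]];
  [:: [:: 0; 0; 0; 0; 0; 1]; [:: 0; 1; -2; 0; 0; 0]; [:: 0; 0; 0; 1; 1; -2]];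
  [:: [:: 0; 0; 0; 1; 0; 0]; [:: 1; -1; -2; -1; 1; 1]; [:: 0; 1; -2; 0; 0; 0]]]%Z.

Definition witnesses_2 : seq (seq (seq int)) := [::
  [:: [:: 0; 0; 1; 0]; [:: 1; -2; 2; -1]];
  [:: [:: 0; 1; 1; 1]; [:: 2; -2; 1; -1]];
  [:: [:: 0; 1; 0; 0; 0]; [:: 1; -2; 2; -2; 2]];
  [:: [:: 2; 0; 1; 0; -1]; [:: 0; 2; -2; 1; 0]];
  [:: [:: 1; -2; 2; 0; 0]; [:: 2; -2; 2; -1; -2]];
  [:: [:: 1; 0; 0; 0; 0]; [:: 2; -2; 2; -2; 1]];
  [:: [:: 1; 1; 0; 0; 0]; [:: 0; 2; -2; 1; -1]];
  [:: [:: 0; 0; 1; 0; 0; 0]; [:: 0; 2; -2; 0; -1; 1]];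
  [:: [:: 0; 0; 1; 0; 0; 0]; [:: 0; 2; -2; 0; 1; -1]];
  [:: [:: -1; 1; -1; 0; -1; 0]; [:: 1; -3; 3; -1; 1; -1]];
  [:: [:: -1; 1; -1; 0; 0; -1]; [:: 1; -3; 3; -1; -1; 1]];
  [:: [:: -1; 0; 0; 0; 0; 0]; [:: 6; -2; 7; -4; -2; -2]];
  [:: [:: 0; -1; 1; -1; 0; 0]; [:: 1; -5; 2; -1; 1; 1]];
  [:: [:: -1; 1; -1; 0; 0; 0]; [:: 1; -2; 5; -1; -1; -1]];
  [:: [:: -1; 0; -1; 0; 0; 0]; [:: 2; -6; 8; -2; 1; -2]];
  [:: [:: 0; -1; 0; -1; 0; 0]; [:: 2; -8; 6; -2; 2; -1]];
  [:: [:: 0; -1; 0; -1; 0; 0]; [:: 2; -8; 6; -2; -1; 2]];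
  [:: [:: -1; 0; -1; 0; 0; 0]; [:: 2; -6; 8; -2; -2; 1]];
  [:: [:: -1; 0; 0; 0; 0; 0]; [:: 6; -4; 7; -2; -2; -2]]]%Z.

Definition witnesses_3 : seq (seq (seq int)) := [::
  [:: [:: 1; -1; -1; -1; 1]; [:: 1; 1; 1; -1; -1]];
  [:: [:: 1; 1; 0; -1; -2]; [:: 1; -1; -2; -1; 2]];
  [:: [:: 1; 0; -1; -1; 1]; [:: 1; 2; 0; -1; -1]];
  [:: [:: 1; 0; 0; -1; 1]; [:: 1; 2; 1; -1; -2]];
  [:: [:: 0; 0; 0; -1; 0; 1]; [:: -1; 0; 0; 0; -1; 2]];
  [:: [:: 0; 0; 0; -1; 1; 0]; [:: -1; 0; 0; 0; 2; -1]];
  [:: [:: -1; 0; 0; 1; 0; 0]; [:: -2; 0; 0; 0; 1; 1]];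
  [:: [:: -1; 0; 0; 0; 0; 1]; [:: 0; 0; 0; 1; 1; -2]];
  [:: [:: -1; 0; 0; 0; 1; 0]; [:: 0; 0; 0; 1; -2; 1]];
  [:: [:: -1; 0; 0; 1; 0; 0]; [:: 0; 0; 0; -2; 1; 1]]]%Z.

Definition forbidden (M : seq (seq nat)) : bool :=
  [|| has (positive_family form_1 M) witnesses_1,
      has (positive_family form_2 M) witnesses_2 |
      has (positive_family form_3 M) witnesses_3].

Lemma not_forbidden n (e : rel 'I_n) v Q vs :
  cone_spectrum e v Q -> ~~ forbidden (distances e vs).
Proof.
move=> [h1 h2 h3 _ _ _]; apply/norP; split; last (apply/norP; split);
  apply/hasPn => us us_in; [apply: h1|apply: h2|apply: h3];
  apply/eqP; move: us us_in; apply/allP; by vm_compute.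
Qed.

(* Vertices [x; v; y; w] with [x - v - y] an induced path and [w] not adjacent
   to [v]. *)
Definition P3_far_table (a b : nat) := [:: [:: 1; 2; a]; [:: 1; 2]; [:: b]; [::]].

Lemma P3_far_forbidden : all (fun a => all (fun b =>
  (a == 2) && (b == 2) || forbidden (P3_far_table a b)) [:: 1; 2]) [:: 1; 2].
Proof. by vm_compute. Qed.

(* Vertices [v; x; y; z] with [v] adjacent to all of the induced path
   [x - y - z], followed by one or two more neighbours of [v]. *)
Definition diamond_table1 (t : seq nat) :=
  [:: [:: 1; 1; 1; 1]; [:: 1; 2; nth 0 t 0]; [:: 1; nth 0 t 1]; [:: nth 0 t 2]; [::]].

Definition diamond_table2 (t s : seq nat) (q : nat) :=
  [:: [:: 1; 1; 1; 1; 1]; [:: 1; 2; nth 0 t 0; nth 0 s 0];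
      [:: 1; nth 0 t 1; nth 0 s 1]; [:: nth 0 t 2; nth 0 s 2]; [:: q]; [::]].

(** The further neighbour of [v] is adjacent to the midpoint [y] and to exactly one end of the
    path. *)
Definition paw_types := [:: [:: 1; 1; 2]; [:: 2; 1; 1]].

Lemma diamond1_forbidden : all (fun a => all (fun b => all (fun c =>
    ([:: a; b; c] \in paw_types) || forbidden (diamond_table1 [:: a; b; c]))
  [:: 1; 2]) [:: 1; 2]) [:: 1; 2].
Proof. by vm_compute. Qed.

Lemma diamond2_forbidden : all (fun t => all (fun s => all (fun q =>
    forbidden (diamond_table2 t s q)) [:: 1; 2]) paw_types) paw_types.
Proof. by vm_compute. Qed.

Lemma P5_forbidden : forbidden [:: [:: 1; 2; 3; 4]; [:: 1; 2; 3]; [:: 1; 2]; [:: 1]; [::]].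
Proof. by vm_compute. Qed.

(* The vertices of a geodesic of length 3, followed by one or two more
   vertices with distances [t] and [s] to it. *)
Definition P4_table1 (t : seq nat) :=
  [:: [:: 1; 2; 3; nth 0 t 0]; [:: 1; 2; nth 0 t 1]; [:: 1; nth 0 t 2];
      [:: nth 0 t 3]; [::]].

Definition P4_table2 (t s : seq nat) (q : nat) :=
  [:: [:: 1; 2; 3; nth 0 t 0; nth 0 s 0]; [:: 1; 2; nth 0 t 1; nth 0 s 1];
      [:: 1; nth 0 t 2; nth 0 s 2]; [:: nth 0 t 3; nth 0 s 3]; [:: q]; [::]].

(** Distances from the four path vertices in order. A clique type forms a triangle with an end edge
    of the path; a fork type is a second leaf beside an end of the path. *)
Definition clique_types := [:: [:: 1; 1; 2; 3]; [:: 3; 2; 1; 1]].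
Definition fork_types := [:: [:: 2; 1; 2; 3]; [:: 3; 2; 1; 2]].

Definition triangle (a b c : nat) := [&& a <= b + c, b <= a + c & c <= a + b].

(** The triangle inequalities discard the tables that no graph realizes. *)
Lemma P4_1_forbidden :
  all (fun a => all (fun b => all (fun c => all (fun d =>
    [&& triangle a b 1, triangle b c 1, triangle c d 1 & triangle a d 3] ==>
    ([:: a; b; c; d] \in clique_types ++ fork_types) || forbidden (P4_table1 [:: a; b; c; d]))
  [:: 1; 2; 3]) [:: 1; 2; 3]) [:: 1; 2; 3]) [:: 1; 2; 3].
Proof. by vm_compute. Qed.

(** A fork vertex tolerates no second extra vertex, and two clique vertices are at distance 1 or 3
    according to whether they lie at the same end. *)
Lemma P4_2_forbidden :
  all (fun t => all (fun s => all (fun q =>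
    all (fun i => triangle (nth 0 t i) (nth 0 s i) q) (iota 0 4) ==>
    ((t \in clique_types) && (s \in clique_types) && (q == if t == s then 1 else 3))
    || forbidden (P4_table2 t s q))
  [:: 1; 2; 3]) (clique_types ++ fork_types)) (clique_types ++ fork_types).
Proof. by vm_compute. Qed.

Lemma geodesic n (e : rel 'I_n) k x y : connected_simple e -> gdist e x y = k ->
  exists2 p : nat -> 'I_n, p 0 = x /\ p k = y &
    forall i j, i <= j <= k -> gdist e (p i) (p j) = j - i.
Proof.
move=> ge; elim: k x => [|k IH] x d.
  move/eqP: d; rewrite gdist_eq0 // => /eqP <-; exists (fun=> x) => // i j.
  by rewrite gdistxx //; lia.
have [z xz /IH[p [p0 pk] pd]] := gdist_step ge d.
exists (fun i => if i is i'.+1 then p i' else x) => // -[|i] [|j] lij //.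
- by rewrite gdistxx.
(* The route through [z] bounds the distance from [x] to [p j] by [j.+1]; the triangle inequality
   towards [y] gives the reverse bound. *)
- rewrite subn0; have := gdist_triangle x (p j) y ge; have := gdist_triangle x z (p j) ge.
  have /eqP -> : gdist e x z == 1 by rewrite gdist_eq1.
  have -> : gdist e z (p j) = j by rewrite -p0 pd ?subn0 //; lia.
  have -> : gdist e (p j) y = k - j by rewrite -pk pd //; lia.
  by rewrite d; lia.
by rewrite pd.
Qed.

Lemma gdist_le3 n (e : rel 'I_n) v Q x y :
  connected_simple e -> cone_spectrum e v Q -> gdist e x y <= 3.
Proof.
move=> ge sp; case: leqP => // lt3.
have [p _ pd] := geodesic ge (erefl (gdist e x y)).
have := not_forbidden (map p (iota 0 5)) sp.
by rewrite /= !pd ?P5_forbidden //; lia.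
Qed.

(** * Sums of squared distances *)

Lemma sum_list n (s : seq 'I_n) (F : 'I_n -> nat) :
  uniq s -> (forall i, i \in s) -> \sum_i F i = \sum_(i <- s) F i.
Proof. by move=> us sT; rewrite [RHS]big_uniq //; apply: eq_bigl => i; rewrite sT. Qed.

Lemma size_list n (s : seq 'I_n) : uniq s -> (forall i, i \in s) -> size s = n.
Proof. by move=> /card_uniqP <- sT; rewrite -[RHS]card_ord; apply: eq_card => i; rewrite sT. Qed.

Lemma sum_cone_split n (v : 'I_n) (Q : {set 'I_n}) (F : 'I_n -> nat) : v \notin Q ->
  \sum_i F i = F v + (\sum_(i in Q) F i + \sum_(i in ~: (v |: Q)) F i).
Proof.
move=> vQ; rewrite (bigID (mem (v |: Q))) /= big_setU1 //= addnA; congr (_ + _).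
by apply: eq_bigl => i; rewrite in_setC.
Qed.

Lemma card_cone_split n (v : 'I_n) (Q : {set 'I_n}) : v \notin Q ->
  1 + (#|Q| + #|~: (v |: Q)|) = n.
Proof. by move=> vQ; have := cardsC (v |: Q); rewrite card_ord cardsU1 vQ addnA. Qed.

Lemma sum_gdist2 n (e : rel 'I_n) v Q : connected_simple e -> cone_spectrum e v Q ->
  \sum_i \sum_j gdist e i j ^ 2 = \sum_i \sum_j gdist (cone_rel v Q) i j ^ 2.
Proof.
have tr2 (e' : rel 'I_n) : connected_simple e' ->
    (\tr (dist_mx e' *m dist_mx e') = (\sum_i \sum_j gdist e' i j ^ 2)%N%:R)%R.
  move=> ge'; rewrite natr_sum; apply: eq_bigr => i _; rewrite mxE natr_sum.
  by apply: eq_bigr => j _; rewrite !mxE (gdistC j) // -natrM mulnn.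
move=> ge /moment2; rewrite !tr2 //; last exact: cone_connected_simple.
by move/eqP; rewrite eqr_nat => /eqP.
Qed.

(** The row sums are [a + b] at [v], [a + 4 b] on [Q] and [4 a + 4 b - 3] elsewhere; [2 * b] stands
    on the left to avoid subtraction in [nat]. *)
Lemma sum_gdist2_cone n (v : 'I_n) (Q : {set 'I_n}) : v \notin Q ->
  let a := #|Q| in let b := #|~: (v |: Q)| in
  \sum_i \sum_j gdist (cone_rel v Q) i j ^ 2 + 2 * b = a ^ 2 + 8 * a * b + 4 * b ^ 2 + a.
Proof.
move=> vQ a b.
have ev : \sum_j gdist (cone_rel v Q) v j ^ 2 = a + b.
  rewrite /a /b (sum_cone_split _ vQ) gdist_cone eqxx add0n.
  by congr (_ + _); rewrite -sum1_card; apply: eq_bigr => j jQ;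
    rewrite gdist_cone eqxx; case: eqP jQ => // <-; rewrite ?(negbTE vQ) // !inE eqxx.
have eQ i : i \in Q -> \sum_j gdist (cone_rel v Q) i j ^ 2 = a + 4 * b.
  move=> iQ; have iv : i != v by apply: contraNneq vQ => <-.
  rewrite (sum_cone_split _ vQ) gdist_cone (negbTE iv) eqxx orbT.
  rewrite addnA; congr (_ + _).
    rewrite (bigD1 i) //= gdist_cone eqxx add0n /a (cardsD1 i) iQ; congr (_ + _).
    rewrite -sum1_card; apply: eq_big => [j|j /andP[jQ ji]]; first by rewrite !inE andbC.
    by rewrite gdist_cone eq_sym (negbTE ji) iQ jQ !orbT.
  rewrite mulnC -sum_nat_const; apply: eq_bigr => j; rewrite !inE negb_or => /andP[jv jQ].
  rewrite gdist_cone (negbTE iv) (negbTE jv) (negbTE jQ) andbF /=.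
  by case: eqP iQ jQ => // -> ->.
have eB i : i \in ~: (v |: Q) -> \sum_j gdist (cone_rel v Q) i j ^ 2 + 4 = 1 + 4 * a + 4 * b.
  rewrite !inE negb_or => /andP[iv iQ].
  have iB : i \in ~: (v |: Q) by rewrite !inE negb_or iv.
  have eQi : \sum_(j in Q) gdist (cone_rel v Q) i j ^ 2 = 4 * a.
    rewrite mulnC -sum_nat_const; apply: eq_bigr => j jQ.
    have jv : j != v by apply: contraNneq vQ => <-.
    rewrite gdist_cone (negbTE iv) (negbTE jv) (negbTE iQ) /=.
    by case: eqP jQ iQ => // -> ->.
  have eBi : \sum_(j in ~: (v |: Q)) gdist (cone_rel v Q) i j ^ 2 + 4 = 4 * b.
    rewrite (bigD1 i) //= gdist_cone eqxx add0n /b (cardsD1 i) iB mulnDr addnC; congr (_ + _).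
    rewrite mulnC -sum_nat_const; apply: eq_big => [j|j /andP[]]; first by rewrite !inE andbC.
    rewrite !inE negb_or => /andP[jv jQ] ji.
    by rewrite gdist_cone eq_sym (negbTE ji) (negbTE iv) (negbTE jv) (negbTE iQ).
  by rewrite (sum_cone_split _ vQ) gdist_cone (negbTE iv) eqxx orbT eQi -eBi; lia.
rewrite (sum_cone_split _ vQ) ev (eq_bigr _ eQ) sum_nat_const -/a.
have : \sum_(i in ~: (v |: Q)) (\sum_j gdist (cone_rel v Q) i j ^ 2 + 4)
       = b * (1 + 4 * a + 4 * b) by rewrite (eq_bigr _ eB) sum_nat_const.
by rewrite big_split /= sum_nat_const -/b; nia.
Qed.

Lemma sum_gdist2_eq n (e : rel 'I_n) v (Q : {set 'I_n}) :
  connected_simple e -> cone_spectrum e v Q -> v \notin Q ->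
  let a := #|Q| in let b := #|~: (v |: Q)| in
  \sum_i \sum_j gdist e i j ^ 2 + 2 * b = a ^ 2 + 8 * a * b + 4 * b ^ 2 + a.
Proof. by move=> ge /(sum_gdist2 ge) -> /sum_gdist2_cone. Qed.

(** The pair [x], [y] contributes at least 18. Each of the other [k] vertices has distances to [x]
    and [y] of sum at least 3, hence squares of sum at least 5, counted twice. The remaining ordered
    pairs give at least [k (k - 1)]. *)
Lemma sum_gdist2_far n (e : rel 'I_n) x y : connected_simple e -> 3 <= gdist e x y ->
  exists2 k, n = k + 2 & k ^ 2 + 9 * k + 18 <= \sum_i \sum_j gdist e i j ^ 2.
Proof.
move=> ge d3; have xy : y != x by apply: contraTneq d3 => ->; rewrite gdistxx.
have ne0 i j : i != j -> 0 < gdist e i j by rewrite lt0n gdist_eq0.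
have [k kE] : {k | k = #|~: [set x; y]|} by exists #|~: [set x; y]|.
have nk : n = k + 2.
  by have := cardsC [set x; y]; rewrite card_ord cards2 eq_sym xy addnC kE.
exists k => //.
have sumE F : \sum_i F i = F x + (F y + \sum_(i in ~: [set x; y]) F i) :> nat.
  rewrite (bigD1 x) //= (bigD1 y) //=; congr (_ + (_ + _)).
  by apply: eq_bigl => i; rewrite !inE negb_or.
have far i : i \in ~: [set x; y] -> 5 <= gdist e i x ^ 2 + gdist e i y ^ 2.
  rewrite !inE negb_or => /andP[ix iy]; have := leq_trans d3 (gdist_triangle x i y ge).
  move: (ne0 _ _ ix) (ne0 _ _ iy); rewrite (gdistC x i) // -!mulnn.
  by move: (gdist e i x) (gdist e i y) => [|[|p]] [|[|q]] //; nia.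
have lo F c : (forall i, i \in ~: [set x; y] -> c <= F i) ->
    k * c <= \sum_(i in ~: [set x; y]) F i.
  by move=> h; rewrite kE -sum_nat_const; apply: leq_sum.
have rows i : i \in ~: [set x; y] -> k + 4 <= \sum_j gdist e i j ^ 2.
  move=> iB; rewrite sumE addnA (bigD1 i) //= (gdistxx i ge) add0n.
  have le_k : k <= 1 + \sum_(j in ~: [set x; y] | j != i) gdist e i j ^ 2.
    rewrite kE (cardsD1 i) iB leq_add2l -sum1_card.
    rewrite (eq_bigl (fun j => (j \in ~: [set x; y]) && (j != i))) => [|j]; last first.
      by rewrite !inE andbC.
    by apply: leq_sum => j /andP[_ ji]; rewrite expn_gt0 ne0 // eq_sym.
  apply: leq_trans (leq_add (far _ iB) (leqnn _)).
  by rewrite -[5]/(1 + 4) addnAC leq_add2r.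
have l1 := lo _ _ rows.
have l2 : k * 5 <= \sum_(j in ~: [set x; y]) (gdist e x j ^ 2 + gdist e y j ^ 2).
  by apply: lo => i /far; rewrite (gdistC x i) // (gdistC y i).
have d9 : 9 <= gdist e x y ^ 2 by rewrite -[9]/(3 ^ 2) leq_sqr.
rewrite !sumE; rewrite big_split /= in l2.
rewrite !gdistxx // (gdistC y x) // -mulnn; move: l1 l2 d9.
move: (\sum_(i in _) _) (\sum_(i in _) _) (\sum_(i in _) _) (gdist e x y ^ 2) => ????; lia.
Qed.

(** * Diameter at least 3 *)

Definition profile n (e : rel 'I_n) (p : nat -> 'I_n) (w : 'I_n) : seq nat :=
  [seq gdist e (p i) w | i <- iota 0 4].

Lemma in_iota3 d : 0 < d -> d <= 3 -> d \in [:: 1; 2; 3].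
Proof. by case: d => [|[|[|[|d]]]]. Qed.

Lemma triangle_gdist n (e : rel 'I_n) x y z : connected_simple e ->
  triangle (gdist e x z) (gdist e y z) (gdist e x y).
Proof.
move=> ge; rewrite /triangle; have := gdist_triangle x y z ge.
have := gdist_triangle y x z ge; have := gdist_triangle x z y ge.
rewrite (gdistC y x) // (gdistC z y) //; lia.
Qed.

Lemma profile_types n (e : rel 'I_n) v Q (p : nat -> 'I_n) w :
  connected_simple e -> cone_spectrum e v Q ->
  (forall i j, i <= j <= 3 -> gdist e (p i) (p j) = j - i) ->
  (forall i, i < 4 -> p i != w) -> profile e p w \in clique_types ++ fork_types.
Proof.
move=> ge sp pd pw.
have rng i : i < 4 -> gdist e (p i) w \in [:: 1; 2; 3].
  by move=> i4; apply: in_iota3; rewrite ?(gdist_le3 _ _ ge sp) // lt0n gdist_eq0 // pw.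
have := P4_1_forbidden.
move=> /allP/(_ _ (rng 0 isT))/allP/(_ _ (rng 1 isT))/allP/(_ _ (rng 2 isT))/allP/(_ _ (rng 3 isT)).
have tr i j : i <= j <= 3 -> triangle (gdist e (p i) w) (gdist e (p j) w) (j - i).
  by move=> ij; rewrite -(pd _ _ ij) triangle_gdist.
have t01 := tr 0 1 isT; have t12 := tr 1 2 isT; have t23 := tr 2 3 isT; have t03 := tr 0 3 isT.
rewrite [triangle _ _ _]t01 [triangle _ _ _]t12 [triangle _ _ _]t23 [triangle _ _ _]t03.
move=> /orP[//|].
have := not_forbidden (map p (iota 0 4) ++ [:: w]) sp.
by rewrite /= !pd // => /negbTE ->.
Qed.

Lemma profile_pair n (e : rel 'I_n) v Q (p : nat -> 'I_n) w w' :
  connected_simple e -> cone_spectrum e v Q ->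
  (forall i j, i <= j <= 3 -> gdist e (p i) (p j) = j - i) ->
  (forall i, i < 4 -> p i != w) -> (forall i, i < 4 -> p i != w') -> w != w' ->
  [&& profile e p w \in clique_types, profile e p w' \in clique_types &
     gdist e w w' == if profile e p w == profile e p w' then 1 else 3].
Proof.
move=> ge sp pd pw pw' ww'.
have rng : gdist e w w' \in [:: 1; 2; 3].
  by apply: in_iota3; rewrite ?(gdist_le3 _ _ ge sp) // lt0n gdist_eq0.
have := P4_2_forbidden.
move=> /allP/(_ _ (profile_types ge sp pd pw))/allP/(_ _ (profile_types ge sp pd pw')).
move=> /allP/(_ _ rng)/implyP.
have -> : all (fun i => triangle (nth 0 (profile e p w) i) (nth 0 (profile e p w') i)
                         (gdist e w w')) (iota 0 4).
  by rewrite /= !(gdistC (p _)) // !triangle_gdist.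
move=> /(_ isT)/orP[/andP[/andP[-> ->] ->] //|].
have := not_forbidden (map p (iota 0 4) ++ [:: w; w']) sp.
by rewrite /= !pd // => /negbTE ->.
Qed.

(* The fork [w - p1 - p2 - p3], [p0 - p1] has five vertices and a second
   moment that no cone attains. *)
Lemma profile_clique n (e : rel 'I_n) v Q (p : nat -> 'I_n) w :
  connected_simple e -> cone_spectrum e v Q -> v \notin Q ->
  (forall i j, i <= j <= 3 -> gdist e (p i) (p j) = j - i) ->
  (forall i, i < 4 -> p i != w) -> profile e p w \in clique_types.
Proof.
move=> ge sp vQ pd pw.
have := profile_types ge sp pd pw; rewrite mem_cat => /orP[//|fw].
(* By [profile_pair] a sixth vertex would force a clique type on [w]; hence the path and [w] exhaust
   the graph. *)
have others w' : (forall i, i < 4 -> p i != w') -> w' = w.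
  move=> pw'; apply/eqP; rewrite eq_sym; apply/negPn/negP => ww'.
  have /and3P[cw _ _] := profile_pair ge sp pd pw pw' ww'.
  by move: fw cw; rewrite !inE => /orP[/eqP->|/eqP->].
pose s := [:: p 0; p 1; p 2; p 3; w].
have ne i j : i < j <= 3 -> p i != p j.
  by move=> ij; rewrite -(gdist_eq0 _ _ ge) pd; lia.
have us : uniq s.
  by rewrite /= !inE !negb_or !ne //= !pw.
have sT i : i \in s.
  rewrite !inE; apply/negPn/negP; rewrite !negb_or => /and5P[i0 i1 i2 i3 /eqP].
  apply; apply: others => -[|[|[|[|]]]] // _; by rewrite eq_sym.
have n5 := size_list us sT.
have ab := card_cone_split vQ; have := sum_gdist2_eq ge sp vQ => /=.
(* A cone on five vertices has [a + b = 4], and then its sum of squared distances is at most 56. *)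
have -> : \sum_i \sum_j gdist e i j ^ 2 = 76.
  rewrite (sum_list _ us sT) /s !big_cons !big_nil !(sum_list _ us sT) !big_cons !big_nil.
  rewrite !gdistxx // !(gdistC w) // (gdistC (p 1) (p 0)) // (gdistC (p 2) (p 0)) //.
  rewrite (gdistC (p 3) (p 0)) // (gdistC (p 2) (p 1)) // (gdistC (p 3) (p 1)) //.
  rewrite (gdistC (p 3) (p 2)) // !pd //.
  by move: fw; rewrite !inE => /orP[] /eqP[] -> -> -> ->.
rewrite -[RHS]n5 /= in ab.
move: ab; move: (#|Q|) (#|~: (v |: Q)|) => a b; case: a => [|[|[|[|[|a]]]]]; case: b => [|[|[|[|[|b]]]]] //; lia.
Qed.

Lemma profile_cases n (e : rel 'I_n) v Q (p : nat -> 'I_n) i :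
  connected_simple e -> cone_spectrum e v Q -> v \notin Q ->
  (forall i j, i <= j <= 3 -> gdist e (p i) (p j) = j - i) ->
  [\/ exists2 k, k < 4 & i = p k,
      (forall k, k < 4 -> p k != i) /\ profile e p i = [:: 1; 1; 2; 3] |
      (forall k, k < 4 -> p k != i) /\ profile e p i = [:: 3; 2; 1; 1]].
Proof.
move=> ge sp vQ pd.
have [/hasP[k]|/hasPn pi] := boolP (has (fun k => p k == i) (iota 0 4)).
  by rewrite mem_iota => k4 /eqP <-; apply: Or31; exists k.
have pi' k : k < 4 -> p k != i by move=> k4; apply: pi; rewrite mem_iota.
have := profile_clique ge sp vQ pd pi'; rewrite !inE => /orP[] /eqP.
  by move=> ?; apply: Or32.
by move=> ?; apply: Or33.
Qed.

(* The remaining graphs of diameter 3: two cliques [p1 |: X] and [p2 |: Y]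
   joined by the edge [p1 p2]. *)
Record joined_cliques n (e : rel 'I_n) (p1 p2 : 'I_n) (X Y : {set 'I_n}) : Prop := {
  jc_p12 : gdist e p1 p2 = 1;
  jc_cover : forall i, (i != p1) && (i != p2) = (i \in X) (+) (i \in Y);
  jc_disj : forall i, i \in X -> i \notin Y;
  jc_Xp : forall i, i \in X -> gdist e i p1 = 1 /\ gdist e i p2 = 2;
  jc_Yp : forall i, i \in Y -> gdist e i p1 = 2 /\ gdist e i p2 = 1;
  jc_X : forall i j, i \in X -> j \in X -> i != j -> gdist e i j = 1;
  jc_Y : forall i j, i \in Y -> j \in Y -> i != j -> gdist e i j = 1;
  jc_XY : forall i j, i \in X -> j \in Y -> gdist e i j = 3;
  jc_X0 : 0 < #|X|;
  jc_Y0 : 0 < #|Y| }.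

Lemma joined_cliques_of_far n (e : rel 'I_n) v Q x y :
  connected_simple e -> cone_spectrum e v Q -> v \notin Q -> gdist e x y = 3 ->
  exists p1 p2 X Y, joined_cliques e p1 p2 X Y.
Proof.
move=> ge sp vQ d3; have [p _ pd] := geodesic ge d3.
have C := fun i => profile_cases i ge sp vQ pd.
have pdC i j : i <= j <= 3 -> gdist e (p j) (p i) = j - i by move=> ?; rewrite gdistC // pd.
have D := (pd 0 1 isT : gdist e (p 0) (p 1) = 1,
  pdC 0 1 isT : gdist e (p 1) (p 0) = 1, pd 0 2 isT : gdist e (p 0) (p 2) = 2,
  pdC 0 2 isT : gdist e (p 2) (p 0) = 2, pd 0 3 isT : gdist e (p 0) (p 3) = 3,
  pdC 0 3 isT : gdist e (p 3) (p 0) = 3, pd 1 2 isT : gdist e (p 1) (p 2) = 1,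
  pdC 1 2 isT : gdist e (p 2) (p 1) = 1, pd 1 3 isT : gdist e (p 1) (p 3) = 2,
  pdC 1 3 isT : gdist e (p 3) (p 1) = 2, pd 2 3 isT : gdist e (p 2) (p 3) = 1,
  pdC 2 3 isT : gdist e (p 3) (p 2) = 1).
(* [X] collects [p 0] and the vertices of type [[:: 1; 1; 2; 3]], [Y] collects [p 3] and those of
   type [[:: 3; 2; 1; 1]]; the bridge is the middle edge of the path. *)
pose X := [set i | gdist e i (p 2) == 2]; pose Y := [set i | gdist e i (p 1) == 2].
have inX i : i \in X -> i = p 0 \/ (forall k, k < 4 -> p k != i) /\ profile e p i = [:: 1; 1; 2; 3].
  rewrite inE => /eqP d; case: (C i) => [[k k4 ei]|h|[_ [_ _ d2 _]]]; [left|by right|].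
    by move: d; rewrite ei; case: k k4 ei => [|[|[|[|k]]]] //; rewrite ?D ?gdistxx.
  by rewrite gdistC // d2 in d.
have inY i : i \in Y -> i = p 3 \/ (forall k, k < 4 -> p k != i) /\ profile e p i = [:: 3; 2; 1; 1].
  rewrite inE => /eqP d; case: (C i) => [[k k4 ei]|[_ [_ d2 _ _]]|h]; [left| |by right].
    by move: d; rewrite ei; case: k k4 ei => [|[|[|[|k]]]] //; rewrite ?D ?gdistxx.
  by rewrite gdistC // d2 in d.
have XY i : i \in X -> i \notin Y.
  by move=> /inX[->|[_ [_ d _ _]]]; rewrite inE ?D // gdistC // d.
exists (p 1), (p 2), X, Y; split=> //; first by rewrite D.
- move=> i; case: (C i) => [[k k4 ->]|[pi [_ d1 d2 _]]|[pi [_ d1 d2 _]]].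
  + rewrite !inE -!(gdist_eq0 _ _ ge).
    by case: k k4 => [|[|[|[|k]]]] //; rewrite ?D ?gdistxx.
  + by rewrite !inE !(eq_sym i) !pi // !(gdistC i) // d1 d2.
  by rewrite !inE !(eq_sym i) !pi // !(gdistC i) // d1 d2.
- by move=> i /inX[->|[_ [_ d1 d2 _]]]; rewrite ?D // !(gdistC i) // d1 d2.
- by move=> i /inY[->|[_ [_ d1 d2 _]]]; rewrite ?D // !(gdistC i) // d1 d2.
- move=> i j /inX[->|[pi ti]] /inX[->|[pj tj]] ij.
  + by rewrite eqxx in ij.
  + by case: tj.
  + by rewrite gdistC //; case: ti.
  by have /and3P[_ _ /eqP->] := profile_pair ge sp pd pi pj ij; rewrite ti tj.
- move=> i j /inY[->|[pi ti]] /inY[->|[pj tj]] ij.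
  + by rewrite eqxx in ij.
  + by case: tj.
  + by rewrite gdistC //; case: ti.
  by have /and3P[_ _ /eqP->] := profile_pair ge sp pd pi pj ij; rewrite ti tj.
- move=> i j iX jY; have ij : i != j by apply: contraTneq iX => ->; apply: contraL jY; apply: XY.
  move: iX jY => /inX[->|[pi ti]] /inY[->|[pj tj]].
  + by rewrite D.
  + by case: tj.
  + by rewrite gdistC //; case: ti.
  by have /and3P[_ _ /eqP->] := profile_pair ge sp pd pi pj ij; rewrite ti tj.
- by apply/card_gt0P; exists (p 0); rewrite inE D.
by apply/card_gt0P; exists (p 3); rewrite inE D.
Qed.

(** The equation at a vertex [j] of a clique expresses [z 0 j] by the sums over [X] and [Y] and the
    values at [p1] and [p2]. So [z] is constant on each clique, and a linear system in four unknowns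
    remains. *)
Lemma joined_cliques_minus2 n (e : rel 'I_n) p1 p2 X Y (z : 'rV[algC]_n) :
  connected_simple e -> joined_cliques e p1 p2 X Y ->
  (z *m dist_mx e = (- 2) *: z)%R -> z = 0%R.
Proof.
move=> ge [d12 cov disj Xp Yp dX dY dXY X0 Y0] ez.
have p21 : p2 != p1 by rewrite -(gdist_eq0 _ _ ge) gdistC // d12.
have split_sum (G : 'I_n -> algC) :
    (\sum_i G i = G p1 + (G p2 + (\sum_(i in X) G i + \sum_(i in Y) G i)))%R.
  rewrite (bigD1 p1) //= (bigD1 p2) //= (bigID (mem X)) /=.
  congr (_ + (_ + (_ + _)))%R; apply: eq_bigl => i; rewrite cov.
    by case iX: (i \in X); rewrite ?andbF ?(negbTE (disj _ iX)).
  by case iX: (i \in X); rewrite ?andbF ?(negbTE (disj _ iX)) ?andbT.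
have col j : (\sum_i z 0 i * (gdist e i j)%:R = - 2 * z 0 j)%R.
  by have /rowP/(_ j) := ez; rewrite !mxE => <-; apply: eq_bigr => i _; rewrite mxE.
pose sX := (\sum_(i in X) z 0 i)%R; pose sY := (\sum_(i in Y) z 0 i)%R.
have c1 : (z 0 p2 + (sX + sY * 2) = - 2 * z 0 p1)%R.
  rewrite -col split_sum gdistxx // mulr0 add0r (gdistC p2) // d12 mulr1.
  by rewrite mulr_suml; congr (_ + (_ + _))%R; apply: eq_bigr => i;
    [move/Xp => [-> _]; rewrite mulr1|move/Yp=> [-> _]].
have c2 : (z 0 p1 + (sX * 2 + sY) = - 2 * z 0 p2)%R.
  rewrite -col split_sum gdistxx // mulr0 add0r d12 mulr1.
  by rewrite mulr_suml; congr (_ + (_ + _))%R; apply: eq_bigr => i;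
    [move/Xp => [_ ->]|move/Yp=> [_ ->]; rewrite mulr1].
have cX j : j \in X -> (sX + z 0 p1 + z 0 p2 * 2 + sY * 3 = - z 0 j)%R.
  move=> jX; have [dj1 dj2] := Xp _ jX.
  have hX : (\sum_(i in X | i != j) z 0 i * (gdist e i j)%:R = \sum_(i in X | i != j) z 0 i)%R.
    by apply: eq_bigr => i /andP[iX ij]; rewrite dX // mulr1.
  have hY : (\sum_(i in Y) z 0 i * (gdist e i j)%:R = sY * 3)%R.
    by rewrite mulr_suml; apply: eq_bigr => i iY; rewrite gdistC // dXY.
  have := col j; rewrite split_sum (gdistC p1) // (gdistC p2) // dj1 dj2.
  have sXE : (sX = z 0 j + \sum_(i in X | i != j) z 0 i)%R by rewrite /sX (bigD1 j).
  rewrite (bigD1 j) //= hX hY gdistxx // sXE => h.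
  have -> : (- z 0 j = - 2 * z 0 j + z 0 j)%R by ring.
  by rewrite -h; ring.
have cY j : j \in Y -> (sY + z 0 p2 + z 0 p1 * 2 + sX * 3 = - z 0 j)%R.
  move=> jY; have [dj1 dj2] := Yp _ jY.
  have hY : (\sum_(i in Y | i != j) z 0 i * (gdist e i j)%:R = \sum_(i in Y | i != j) z 0 i)%R.
    by apply: eq_bigr => i /andP[iY ij]; rewrite dY // mulr1.
  have hX : (\sum_(i in X) z 0 i * (gdist e i j)%:R = sX * 3)%R.
    by rewrite mulr_suml; apply: eq_bigr => i iX; rewrite dXY.
  have := col j; rewrite split_sum (gdistC p1) // (gdistC p2) // dj1 dj2 hX.
  have sYE : (sY = z 0 j + \sum_(i in Y | i != j) z 0 i)%R by rewrite /sY (bigD1 j).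
  rewrite (bigD1 j) //= hY gdistxx // sYE => h.
  have -> : (- z 0 j = - 2 * z 0 j + z 0 j)%R by ring.
  by rewrite -h; ring.
have sumX : ((sX + z 0 p1 + z 0 p2 * 2 + sY * 3) *+ #|X| = - sX)%R.
  by rewrite -sumr_const -sumrN; apply: eq_bigr => j /cX.
have sumY : ((sY + z 0 p2 + z 0 p1 * 2 + sX * 3) *+ #|Y| = - sY)%R.
  by rewrite -sumr_const -sumrN; apply: eq_bigr => j /cY.
(* The equation at [p2] eliminates both bridge values from the equations on [X]; symmetrically, the
   one at [p1] serves for [Y]. *)
have eX : (sX + z 0 p1 + z 0 p2 * 2 + sY * 3 = sY * 2 - sX)%R.
  by rewrite -[RHS]addr0 -(subrr (- 2 * z 0 p2))%R -{1}c2; ring.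
have eY : (sY + z 0 p2 + z 0 p1 * 2 + sX * 3 = sX * 2 - sY)%R.
  by rewrite -[RHS]addr0 -(subrr (- 2 * z 0 p1))%R -{1}c1; ring.
rewrite eX in sumX; rewrite eY in sumY; clearbody sX sY.
move: sumX sumY; rewrite -[(_ *+ #|X|)%R]mulr_natr -[(_ *+ #|Y|)%R]mulr_natr.
(* Eliminating [sY] leaves [sX] times a nonzero integer determinant. *)
set x := (#|X|%:R : algC)%R; set y := (#|Y|%:R : algC)%R => sumX sumY.
have det0 : (x * y * 3 + x + y - 1 != 0)%R.
  rewrite lt0r_neq0 // /x /y -!natrM -!natrD subr_gt0 -[1%R]/(1%:R)%R ltr_nat; nia.
have sX0 : sX = 0%R.
  apply: (mulIf det0); rewrite mul0r.
  transitivity ((y - 1) * ((sY * 2 - sX) * x + sX) + x * 2 * ((sX * 2 - sY) * y + sY))%R.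
    by ring.
  by rewrite sumX sumY; ring.
have sY0 : sY = 0%R.
  apply: (mulIf det0); rewrite mul0r.
  transitivity ((x - 1) * ((sX * 2 - sY) * y + sY) + y * 2 * ((sY * 2 - sX) * x + sX))%R.
    by ring.
  by rewrite sumX sumY; ring.
have z20 : (z 0 p2 = - 2 * z 0 p1)%R by rewrite -c1 sX0 sY0; ring.
have z10 : (z 0 p1 = 0)%R.
  apply: (@mulIf _ 3%R); rewrite ?pnatr_eq0 // mul0r.
  have : (z 0 p1 = - 2 * z 0 p2)%R by rewrite -c2 sX0 sY0; ring.
  rewrite z20 => /eqP; rewrite -subr_eq0 => /eqP h.
  by rewrite -[RHS]oppr0 -[in RHS]h; ring.
apply/rowP => j; rewrite mxE; have := cov j.
case: (eqVneq j p1) => [->|j1] //=; case: (eqVneq j p2) => [->|j2] /=.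
  by rewrite z20 z10 mulr0.
move=> jXY; case jX: (j \in X) jXY => jXY.
  by apply/eqP; rewrite -oppr_eq0 -cX // sX0 sY0 z20 z10; apply/eqP; ring.
by apply/eqP; rewrite -oppr_eq0 -cY // sX0 sY0 z20 z10; apply/eqP; ring.
Qed.

Lemma gdist_le2 n (e : rel 'I_n) v (Q : {set 'I_n}) x y :
  connected_simple e -> cone_spectrum e v Q -> v \notin Q -> 0 < #|~: (v |: Q)| ->
  gdist e x y <= 2.
Proof.
move=> ge sp vQ b0; case: leqP => // far.
have d3 : gdist e x y = 3 by apply/eqP; rewrite eqn_leq (gdist_le3 _ _ ge sp).
have nE := card_cone_split vQ.
case: (leqP #|~: (v |: Q)| 1) => b1.
  (* For [b = 1] the cone gives [a ^ 2 + 9 a + 2], below the bound [k ^ 2 + 9 k + 18] with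
     [k = a]. *)
  have := sum_gdist2_eq ge sp vQ => /=; have [k nk] := sum_gdist2_far ge far.
  move: nE b0 b1; rewrite [X in _ = X -> _]nk; move: (\sum_i _) => T.
  move: #|Q| #|~: (v |: Q)| => a b; case: b => [|[|b]] // ab _ _.
  by have -> : k = a by [lia]; rewrite -!mulnn; lia.
have /card_gt1P[p [q [pB qB pq]]] := b1.
move: pB qB; rewrite !inE !negb_or => /andP[pv pQ] /andP[qv qQ].
have [z z0 ez] := minus2 sp pq pv qv pQ qQ.
have [p1 [p2 [X [Y jc]]]] := joined_cliques_of_far ge sp vQ d3.
by rewrite (joined_cliques_minus2 ge jc ez) eqxx in z0.
Qed.

(** * Diameter 2 *)

Lemma in_iota2 n (e : rel 'I_n) x y : connected_simple e ->
  gdist e x y <= 2 -> x != y -> gdist e x y \in [:: 1; 2].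
Proof. by move=> ge d2; rewrite -(gdist_eq0 _ _ ge); case: (gdist e x y) d2 => [|[|[|d]]]. Qed.

(** A vertex [w] not adjacent to the centre [v] is not adjacent to the ends either. A common
    neighbour [u] of [v] and [w] is then adjacent to all of [x], [v], [y], [w], a configuration
    excluded by [diamond1_forbidden]. *)
Lemma P3_centre_dominates n (e : rel 'I_n) v0 (Q : {set 'I_n}) x v y w :
  connected_simple e -> cone_spectrum e v0 Q -> (forall a b, gdist e a b <= 2) ->
  gdist e x v = 1 -> gdist e v y = 1 -> gdist e x y = 2 -> w != v -> gdist e v w = 1.
Proof.
move=> ge sp d2 xv vy xy wv.
have tab a b c w' : gdist e a b = 1 -> gdist e b c = 1 -> gdist e a c = 2 ->
    gdist e b w' = 2 -> gdist e a w' = 2 /\ gdist e c w' = 2.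
  move=> ab bc ac bw.
  have aw : a != w' by apply: contra_eqN bw => /eqP <-; rewrite gdistC // ab.
  have cw : c != w' by apply: contra_eqN bw => /eqP <-; rewrite bc.
  have := P3_far_forbidden.
  move=> /allP/(_ _ (in_iota2 ge (d2 a w') aw))/allP/(_ _ (in_iota2 ge (d2 c w') cw)).
  case/orP => [/andP[/eqP-> /eqP->] //|].
  have := not_forbidden [:: a; b; c; w'] sp.
  by rewrite /= ab bc ac bw => /negbTE ->.
have /orP[/eqP //|/eqP vw] : (gdist e v w == 1) || (gdist e v w == 2).
  by have := in_iota2 ge (d2 v w); rewrite eq_sym => /(_ wv); rewrite !inE.
have [xw yw] := tab _ _ _ _ xv vy xy vw.
have [u vu uw] := gdist_step ge vw; rewrite -gdist_eq1 // in vu; move/eqP: vu => vu.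
(* Otherwise [v - u - w] would be a path with the vertex [a] far from [u]. *)
have near a : gdist e a v = 1 -> gdist e a w = 2 -> gdist e u a = 1.
  move=> av aw; have ua : u != a by apply: contra_eqN aw => /eqP <-; rewrite uw.
  have := in_iota2 ge (d2 u a) ua; rewrite !inE => /orP[/eqP //|/eqP ua2].
  have [] := tab _ _ _ _ vu uw vw ua2; by rewrite gdistC // av.
have ux := near _ xv xw; have uy : gdist e u y = 1 by apply: near => //; rewrite gdistC.
have := not_forbidden [:: u; x; v; y; w] sp.
rewrite /= ux (gdistC u v) // vu uy uw xv xy xw vy vw yw.
have /allP/(_ 2 isT)/allP/(_ 2 isT)/allP/(_ 2 isT)/orP[//|bad] := diamond1_forbidden.
by rewrite [forbidden _]bad.
Qed.

(* An induced path in the link of a dominating vertex leaves room for at most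
   five vertices, and too few pairs at distance 2. *)
Lemma link_P3_free n (e : rel 'I_n) v0 (Q : {set 'I_n}) v x y z :
  connected_simple e -> cone_spectrum e v0 Q -> v0 \notin Q -> 1 < #|Q| ->
  0 < #|~: (v0 |: Q)| ->
  (forall w, w != v -> gdist e v w = 1) -> x != v -> y != v -> z != v ->
  gdist e x y = 1 -> gdist e y z = 1 -> gdist e x z != 2.
Proof.
move=> ge sp vQ Q2 b0 dom xv yv zv xy yz; apply/eqP => xz.
have d2 a b : gdist e a b <= 2 by apply: (gdist_le2 _ _ ge sp).
have ne a b : gdist e a b != 0 -> a != b by rewrite gdist_eq0.
have ab := card_cone_split vQ; have mom := sum_gdist2_eq ge sp vQ.
have pw w : v != w -> x != w -> y != w -> z != w ->
    [:: gdist e x w; gdist e y w; gdist e z w] \in paw_types.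
  move=> vw xw yw zw; have := diamond1_forbidden.
  move=> /allP/(_ _ (in_iota2 ge (d2 x w) xw))/allP/(_ _ (in_iota2 ge (d2 y w) yw)).
  move=> /allP/(_ _ (in_iota2 ge (d2 z w) zw))/orP[//|].
  have := not_forbidden [:: v; x; y; z; w] sp.
  rewrite /= (dom x) // (dom y) // (dom z) // (dom w) 1?eq_sym // xy yz xz.
  by move=> /negbTE ->.
have us : uniq [:: v; x; y; z].
  by rewrite /= !inE !negb_or ![v == _]eq_sym xv yv zv !ne // ?xy ?yz ?xz.
have [w|all4] := pickP (fun w => w \notin [:: v; x; y; z]); last first.
  have sT i : i \in [:: v; x; y; z] by have := all4 i => /negbFE.
  have n4 := size_list us sT; move: mom => /=; rewrite -[RHS]n4 /= in ab.
  (* On four vertices only [a = 2], [b = 1] is possible, and that cone gives 24. *)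
  have -> : \sum_i \sum_j gdist e i j ^ 2 = 18.
    rewrite (sum_list _ us sT) !big_cons !big_nil !(sum_list _ us sT) !big_cons !big_nil.
    rewrite !gdistxx // !(gdistC _ v) // !dom // (gdistC y x) // (gdistC z y) // (gdistC z x) //.
    by rewrite xy yz xz.
  move: ab Q2 b0; move: (#|Q|) (#|~: (v0 |: Q)|) => a b; case: a => [|[|[|[|a]]]]; case: b => [|[|[|b]]] //; lia.
rewrite !inE !negb_or => /and4P[wv wx wy wz].
have us5 : uniq [:: w; v; x; y; z] by rewrite cons_uniq us !inE !negb_or wv wx wy wz.
have tw : [:: gdist e x w; gdist e y w; gdist e z w] \in paw_types by rewrite pw // eq_sym.
have [w'|all5] := pickP (fun w' => w' \notin [:: w; v; x; y; z]); last first.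
  have sT i : i \in [:: w; v; x; y; z] by have := all5 i => /negbFE.
  have n5 := size_list us5 sT; move: mom => /=; rewrite -[RHS]n5 /= in ab.
  (* On five vertices the admissible cones give 38 for [b = 1] and 50 for [b = 2]. *)
  have -> : \sum_i \sum_j gdist e i j ^ 2 = 32.
    rewrite (sum_list _ us5 sT) !big_cons !big_nil !(sum_list _ us5 sT) !big_cons !big_nil.
    rewrite !gdistxx // !(gdistC _ v) // !dom // (gdistC y x) // (gdistC z y) // (gdistC z x) //.
    rewrite !(gdistC w) // xy yz xz.
    by move: tw; rewrite !inE => /orP[] /eqP[] -> -> ->.
  move: ab Q2 b0; move: (#|Q|) (#|~: (v0 |: Q)|) => a b; case: a => [|[|[|[|[|a]]]]]; case: b => [|[|[|[|b]]]] //; lia.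
rewrite !inE !negb_or => /and5P[ww wv' wx' wy' wz'].
have tw' : [:: gdist e x w'; gdist e y w'; gdist e z w'] \in paw_types by rewrite pw // eq_sym.
have := not_forbidden [:: v; x; y; z; w; w'] sp.
have := diamond2_forbidden; move=> /allP/(_ _ tw)/allP/(_ _ tw').
have ww2 : w != w' by rewrite eq_sym.
move=> /allP/(_ _ (in_iota2 ge (d2 w w') ww2)) bad.
rewrite /= (dom x) // (dom y) // (dom z) // (dom w) // (dom w') // xy yz xz.
by rewrite [forbidden _]bad.
Qed.

(** * Cones over disjoint cliques *)

Definition degree n (e : rel 'I_n) (i : 'I_n) : nat := \sum_j e i j.

(* A disjoint union of cliques with a cone vertex [v] added. *)
Record cluster_cone n (e : rel 'I_n) (v : 'I_n) : Prop := ClusterCone {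
  cc_simple : connected_simple e;
  cc_dom : forall w, w != v -> e v w;
  cc_trans : forall x y z, x != v -> y != v -> z != v ->
    e x y -> e y z -> x != z -> e x z }.

Lemma cone_cluster_cone n (v : 'I_n) Q : cluster_cone (cone_rel v Q) v.
Proof.
split; first exact: cone_connected_simple.
  by move=> w wv; rewrite /cone_rel eq_sym wv eqxx.
move=> x y z xv yv zv; rewrite /cone_rel (negbTE xv) (negbTE yv) (negbTE zv) /=.
by move=> /and3P[_ -> _] /and3P[_ _ ->] ->.
Qed.

Lemma cluster_gdist n (e : rel 'I_n) v i j : cluster_cone e v ->
  gdist e i j = if i == j then 0 else if e i j then 1 else 2.
Proof.
move=> [ge dom _]; have [[_ eC] _] := ge.
case: (eqVneq i j) => [->|ij]; first exact: gdistxx.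
case: ifPn => [eij|nij]; first by apply/eqP; rewrite gdist_eq1.
have [iv|iv] := eqVneq i v.
  by case/negP: nij; rewrite iv dom // -iv eq_sym.
have [jv|jv] := eqVneq j v; first by case/negP: nij; rewrite jv eC dom.
by apply: (gdist_eq2 (z := v)) => //; [rewrite eC|]; apply: dom.
Qed.

Lemma degree_cone n (e : rel 'I_n) v : cluster_cone e v -> degree e v + 1 = n.
Proof.
move=> [[[ei _] _] dom _]; rewrite /degree (bigD1 v) //= ei add0n.
rewrite (eq_bigr (fun=> 1)) => [|w wv]; last by rewrite dom.
rewrite sum1_card (eq_card (B := predC1 v)) // cardC1 card_ord addn1 prednK //.
exact: leq_ltn_trans (ltn_ord v).
Qed.

(** Squared distances are 0, 1 or 4, so entrywise 4 is the square plus 3 on edges plus 4 on the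
    diagonal. The second moment thus determines the sum of the degrees. *)
Lemma sum_gdist2_cluster n (e : rel 'I_n) v : cluster_cone e v ->
  \sum_i \sum_j gdist e i j ^ 2 + 3 * \sum_i degree e i + 4 * n = 4 * n ^ 2.
Proof.
move=> cc; have [[[ei _] _] _ _] := cc.
have -> : 4 * n ^ 2 = \sum_(i < n) \sum_(j < n) 4.
  by rewrite !sum_nat_const card_ord; lia.
have -> : 4 * n = \sum_(i < n) \sum_(j < n) 4 * (i == j).
  rewrite mulnC -[X in X * _]card_ord -sum_nat_const; apply: eq_bigr => i _.
  rewrite (bigD1 i) //= eqxx big1 ?addn0 // => j; by rewrite eq_sym => /negbTE ->.
rewrite big_distrr -!big_split; apply: eq_bigr => i _ /=.
rewrite big_distrr -!big_split; apply: eq_bigr => j _ /=.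
by rewrite (cluster_gdist _ _ cc); case: eqVneq => [->|_]; rewrite ?ei //; case: (e i j).
Qed.

(** Every neighbour of [i] other than [j] is adjacent to [j]: either one of the two is [v], or both
    lie in the clique of [i]. *)
Lemma common_neighbours n (e : rel 'I_n) v i j : cluster_cone e v -> i != v -> e i j ->
  \sum_k (e i k && e k j) + 1 = degree e i.
Proof.
move=> cc iv eij; have [[[ei eC] _] dom tr] := cc.
rewrite /degree (bigD1 j) //= ei andbF add0n [RHS](bigD1 j) //= eij addnC; congr (_ + _).
apply: eq_bigr => k kj; case eik: (e i k) => //=.
have [kv|kv] := eqVneq k v; first by rewrite kv dom // -kv eq_sym.
have [jv|jv] := eqVneq j v; first by rewrite jv eC dom.
by rewrite (tr k i j) // eC.
Qed.

(** * Traces and degree moments *)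

Local Open Scope ring_scope.

(** Applied to [P = 2 J] and [M = A + 2 I], with [J] the all-ones matrix: the mixed traces become
    entry sums. *)
Lemma mxtrace_cube_sub n (P M : 'M[algC]_n) :
  \tr ((P - M) *m (P - M) *m (P - M)) =
  \tr (P *m P *m P) - \tr (P *m P *m M) * 3 + \tr (P *m M *m M) * 3 - \tr (M *m M *m M).
Proof.
have e1 : \tr (P *m M *m P) = \tr (P *m P *m M) by rewrite mxtrace_mulC mulmxA.
have e2 : \tr (M *m P *m P) = \tr (P *m P *m M) by rewrite mxtrace_mulC mulmxA e1.
have e3 : \tr (M *m P *m M) = \tr (P *m M *m M) by rewrite -mulmxA mxtrace_mulC.
have e4 : \tr (M *m M *m P) = \tr (P *m M *m M) by rewrite mxtrace_mulC mulmxA.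
rewrite !(mulmxBl, mulmxBr) !raddfB /= e1 e2 e3 e4.
by ring.
Qed.

Definition entry_sum n (X : 'M[algC]_n) : algC := \sum_i \sum_j X i j.

Lemma mxtrace_const1_mul n (X : 'M[algC]_n) : \tr (const_mx 1 *m X) = entry_sum X.
Proof.
rewrite /entry_sum exchange_big /=; apply: eq_bigr => j _; rewrite mxE.
by apply: eq_bigr => i _; rewrite mxE mul1r.
Qed.

Lemma const1_sqr n : (const_mx 1 : 'M[algC]_n) *m (const_mx 1 : 'M_n) = n%:R *: const_mx 1.
Proof.
apply/matrixP => i j; rewrite !mxE (eq_bigr (fun=> 1)) => [|k _]; last by rewrite !mxE mulr1.
by rewrite sumr_const card_ord mulr1.
Qed.

Lemma entry_sum1 n : entry_sum (1%:M : 'M[algC]_n) = n%:R.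
Proof.
rewrite -mxtrace_const1_mul mulmx1 /mxtrace (eq_bigr (fun=> 1)) => [|i _]; last by rewrite mxE.
by rewrite sumr_const card_ord.
Qed.

Definition adj_mx n (e : rel 'I_n) : 'M[algC]_n := \matrix_(i, j) (e i j)%:R.

Lemma dist_mx_cluster n (e : rel 'I_n) v : cluster_cone e v ->
  dist_mx e = 2 *: const_mx 1 - (adj_mx e + 2 *: 1%:M).
Proof.
move=> cc; have [[[ei _] _] _ _] := cc.
apply/matrixP => i j; rewrite !mxE (cluster_gdist _ _ cc).
by case: eqVneq => [->|_]; rewrite ?ei; [|case: (e i j)]; rewrite /= ?mulr1n; ring.
Qed.

(** For the cube, [common_neighbours] gives [deg (deg - 1)] closed walks at each vertex off [v], and
    [deg - 1] for each first step from [v]; together, the sum of [deg ^ 2 - 1] off [v]. *)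
Lemma adj_mx_sums n (e : rel 'I_n) v : cluster_cone e v ->
  let A := adj_mx e in let S := ((\sum_i degree e i)%N)%:R in
  let S2 := ((\sum_i degree e i ^ 2)%N)%:R in
  [/\ \tr A = 0, entry_sum A = S, \tr (A *m A) = S, entry_sum (A *m A) = S2 &
      \tr (A *m A *m A) = S2 - n%:R * (n%:R - 1)].
Proof.
move=> cc A S S2; have [[[ei eC] _] dom _] := cc.
have degE i : (degree e i)%:R = \sum_j A i j.
  by rewrite natr_sum; apply: eq_bigr => j _; rewrite mxE.
have degE' j : (degree e j)%:R = \sum_i A i j.
  by rewrite degE; apply: eq_bigr => i _; rewrite !mxE eC.
split.
- by apply: big1 => i _; rewrite mxE ei.
- by rewrite /S natr_sum; apply: eq_bigr => i _.
- rewrite /S natr_sum; apply: eq_bigr => i _; rewrite mxE degE.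
  by apply: eq_bigr => j _; rewrite !mxE (eC j) -natrM mulnb andbb.
- have -> : entry_sum (A *m A) = \sum_k (\sum_i A i k) * (\sum_j A k j).
    under [RHS]eq_bigr => k _ do rewrite mulr_suml.
    rewrite exchange_big; apply: eq_bigr => i _ /=.
    under [RHS]eq_bigr => k _ do rewrite mulr_sumr.
    rewrite exchange_big; apply: eq_bigr => j _ /=.
    by rewrite mxE.
  rewrite /S2 natr_sum; apply: eq_bigr => k _.
  by rewrite -degE -degE' -natrM mulnn.
have AA i j : (A *m A) i j = ((\sum_k (e i k && e k j))%N)%:R.
  rewrite mxE natr_sum; apply: eq_bigr => k _.
  by rewrite !mxE -natrM mulnb.
have AAi i : i != v -> (A *m A *m A) i i = (degree e i)%:R ^+ 2 - (degree e i)%:R.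
  move=> iv; rewrite mxE expr2 -[X in _ - X]mulr1 -mulrBr [X in X * _]degE mulr_suml.
  apply: eq_bigr => j _; rewrite AA [A j i]mxE [A i j]mxE (eC j).
  case eij: (e i j); rewrite ?mulr0 ?mul0r // mulr1 mul1r.
  by rewrite -(common_neighbours cc iv eij) natrD addrK.
have AAv : (A *m A *m A) v v = \sum_(j | j != v) ((degree e j)%:R - 1).
  rewrite mxE (bigD1 v) //= [A v v]mxE ei mulr0 add0r; apply: eq_bigr => j jv.
  rewrite AA [A j v]mxE eC dom // mulr1 -(common_neighbours cc jv (j := v)) ?natrD ?addrK.
    by congr (_%:R); apply: eq_bigr => k _; rewrite andbC (eC v) (eC k).
  by rewrite eC dom.
rewrite /mxtrace (bigD1 v) //= AAv (eq_bigr _ AAi) -big_split /= /S2 natr_sum [in RHS](bigD1 v) //=.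
have dv : (degree e v)%:R = n%:R - 1 :> algC.
  by have /(congr1 (fun k => k%:R : algC)) := degree_cone cc; rewrite natrD => <-; rewrite addrK.
have cv : \sum_(j < n | j != v) 1 = n%:R - 1 :> algC.
  rewrite -dv degE [RHS](bigD1 v) //= [A v v]mxE ei add0r; apply: eq_bigr => j jv.
  by rewrite mxE dom.
rewrite natrX dv (eq_bigr (fun j => (degree e j ^ 2)%:R - 1)) => [|j _]; last first.
  by rewrite natrX; ring.
by rewrite sumrB cv; ring.
Qed.

(** The coefficient of [S2] is [6 - 1], from the mixed term and from the cube of [M]. Being nonzero,
    it lets the third moment determine [S2] once [S] is known. *)
Lemma mxtrace_dist_cube n (e : rel 'I_n) v : cluster_cone e v ->
  let S := ((\sum_i degree e i)%N)%:R in let S2 := ((\sum_i degree e i ^ 2)%N)%:R in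
  let N := n%:R in
  \tr (dist_mx e *m dist_mx e *m dist_mx e) =
  S2 * 5 + S * (18 - N * 12) + N * (8 * N ^+ 2 - 24 * N + 24 - 8) + N * (N - 1).
Proof.
move=> cc S S2 N; rewrite (dist_mx_cluster cc).
have [trA sA trA2 sA2 trA3] := adj_mx_sums cc.
set A := adj_mx e in trA sA trA2 sA2 trA3 *.
set M := A + 2 *: 1%:M; set J : 'M[algC]_n := const_mx 1.
have sD (X Y : 'M[algC]_n) : entry_sum (X + Y) = entry_sum X + entry_sum Y.
  by rewrite -!mxtrace_const1_mul mulmxDr mxtraceD.
have sZ a (X : 'M[algC]_n) : entry_sum (a *: X) = a * entry_sum X.
  by rewrite -!mxtrace_const1_mul -scalemxAr mxtraceZ.
have eMM : M *m M = A *m A + 4 *: A + 4 *: 1%:M.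
  rewrite /M !(mulmxDl, mulmxDr) -!scalemxAl -!scalemxAr !mulmx1 !mul1mx scalerA.
  rewrite -!addrA; congr (_ + _); rewrite !addrA -scalerDl.
  by congr (_ *: _ + _ *: _); ring.
have sM : entry_sum M = S + N * 2 by rewrite /M sD sZ entry_sum1 sA mulrC.
have sMM : entry_sum (M *m M) = S2 + S * 4 + N * 4.
  by rewrite eMM !sD !sZ entry_sum1 sA sA2 -/N -/S -/S2; ring.
have trMMM : \tr (M *m M *m M) = S2 - N * (N - 1) + S * 6 + N * 8.
  rewrite eMM /M !(mulmxDl, mulmxDr) -!scalemxAl -!scalemxAr !mulmx1 !mul1mx.
  rewrite -?scalemxAl !mxtraceD !mxtraceZ mxtrace1 trA trA2 trA3 -/N -/S -/S2.
  by ring.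
rewrite mxtrace_cube_sub -!scalemxAl -!scalemxAr -!scalemxAl -/J const1_sqr -/N.
rewrite -!scalemxAl const1_sqr -/N !mxtraceZ -!mulmxA.
rewrite !mxtrace_const1_mul mulmxA trMMM sM sMM.
have -> : \tr J = N.
  by rewrite -[J]mulmx1 mxtrace_const1_mul entry_sum1.
by ring.
Qed.

Local Close Scope ring_scope.

Lemma degree_moments n (e : rel 'I_n) v v0 Q :
  cluster_cone e v -> cone_spectrum e v0 Q ->
  \sum_i degree e i = \sum_i degree (cone_rel v0 Q) i /\
  \sum_i degree e i ^ 2 = \sum_i degree (cone_rel v0 Q) i ^ 2.
Proof.
move=> cc sp; have ck := cone_cluster_cone v0 Q.
have eS : \sum_i degree e i = \sum_i degree (cone_rel v0 Q) i.
  have := sum_gdist2_cluster cc; have := sum_gdist2_cluster ck.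
  rewrite (sum_gdist2 (cc_simple cc) sp).
  move: (\sum_i _) (\sum_i degree e i) (\sum_i degree _ i) => T S S'; lia.
split=> //; have := moment3 sp.
rewrite (mxtrace_dist_cube cc) (mxtrace_dist_cube ck) eS => /addIr/addIr/addIr/mulIf h.
by apply/eqP; rewrite -(eqr_nat algC) h // pnatr_eq0.
Qed.

Lemma degree_sums_cone n (v : 'I_n) (Q : {set 'I_n}) : v \notin Q ->
  let a := #|Q| in let b := #|~: (v |: Q)| in
  \sum_(i | i != v) degree (cone_rel v Q) i = a * a + b /\
  \sum_(i | i != v) degree (cone_rel v Q) i ^ 2 = a * a ^ 2 + b.
Proof.
move=> vQ a b.
have dQ i : i \in Q -> degree (cone_rel v Q) i = a.
  move=> iQ; have iv : i != v by apply: contraNneq vQ => <-.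
  rewrite /degree (sum_cone_split _ vQ) /cone_rel iv eqxx orbT /=.
  rewrite [X in _ + (_ + X)]big1 => [|j]; last first.
    by rewrite !inE negb_or => /andP[jv jQ]; rewrite (negbTE iv) (negbTE jv) (negbTE jQ) !andbF.
  rewrite addn0 (bigD1 i) //= eqxx add0n /a (cardsD1 i) iQ; congr (_ + _).
  rewrite -sum1_card; apply: eq_big => [j|j /andP[jQ ji]]; first by rewrite !inE andbC.
  by rewrite eq_sym ji jQ !orbT.
have dB i : i \in ~: (v |: Q) -> degree (cone_rel v Q) i = 1.
  rewrite !inE negb_or => /andP[iv iQ].
  rewrite /degree (bigD1 v) //= big1 => [|j jv]; first by rewrite /cone_rel iv eqxx orbT.
  by rewrite /cone_rel (negbTE iv) (negbTE jv) (negbTE iQ) andbF.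
have sumE (F : 'I_n -> nat) : \sum_(i | i != v) F i =
    \sum_(i in Q) F i + \sum_(i in ~: (v |: Q)) F i.
  by apply: (@addnI (F v)); rewrite -(sum_cone_split _ vQ) [RHS](bigD1 v).
rewrite !sumE (eq_bigr _ dQ) (eq_bigr _ dB) !sum_nat_const -/a -/b muln1; split=> //.
congr (_ + _); first by rewrite -sum_nat_const; apply: eq_bigr => i /dQ ->.
by rewrite -[RHS]muln1 -sum_nat_const; apply: eq_bigr => i /dB ->.
Qed.

(* Writing [c = deg - 1] off the cone vertex, the moments give
   [sum c = a (a - 1)] and [sum c deg = a^2 (a - 1)]. Some vertex has degree at
   least [a]; its clique alone already exhausts [sum c]. *)
Lemma cluster_cone_single_clique n (e : rel 'I_n) v a b :
  cluster_cone e v -> 1 < a -> 1 + (a + b) = n ->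
  \sum_(i | i != v) degree e i = a * a + b ->
  \sum_(i | i != v) degree e i ^ 2 = a * a ^ 2 + b ->
  exists2 C : {set 'I_n}, v \notin C /\ #|C| = a & e =2 cone_rel v C.
Proof.
move=> cc a1 abn s1 s2; have [[[ei eC] _] dom tr] := cc.
have d1 i : i != v -> 0 < degree e i.
  by move=> iv; rewrite /degree (bigD1 v) //= eC dom.
have cv : \sum_(i < n | i != v) 1 = a + b.
  have := degree_cone cc; rewrite /degree (bigD1 v) //= ei add0n.
  rewrite (eq_bigr (fun=> 1)) => [|i iv]; last by rewrite dom.
  by move=> h; apply: (@addnI 1); rewrite addnC h.
pose c i := (degree e i).-1.
have cE i : i != v -> degree e i = c i + 1 by move=> /d1; rewrite /c; lia.
have sc : \sum_(i | i != v) c i + a = a * a.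
  have : \sum_(i | i != v) (c i + 1) = a * a + b.
    by rewrite -s1; apply: eq_bigr => i /cE.
  by rewrite big_split /= cv; lia.
have scd : \sum_(i | i != v) c i * degree e i + a * a = a * a ^ 2.
  have : \sum_(i | i != v) (c i * degree e i + degree e i) = a * a ^ 2 + b.
    by rewrite -s2; apply: eq_bigr => i /cE ->; lia.
  by rewrite big_split /= s1; lia.
(* The sum of [c * deg] is [a] times the sum of [c]. If all degrees were below [a], the sum of [c]
   would vanish, forcing [a = 1]. *)
have [u /andP[uv ua]] : exists u, (u != v) && (a <= degree e u).
  apply/existsP; apply: contraT; rewrite negb_exists => /forallP small.
  have : \sum_(i | i != v) c i * degree e i <= \sum_(i | i != v) c i * a.-1.
    apply: leq_sum => i iv; rewrite leq_mul2l; apply/orP; right.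
    by have := small i; rewrite iv /=; lia.
  rewrite -big_distrl /=.
  have -> : \sum_(i | i != v) c i * degree e i = (\sum_(i | i != v) c i) * a.
    by apply: (@addIn (a * a)); rewrite scd -mulnDl sc -mulnn mulnA.
  rewrite leq_mul2l [a <= a.-1]leqNgt prednK ?leqnn ?orbF; last exact: ltnW.
  move/eqP => S0; move: sc; rewrite S0 add0n -[LHS]muln1 => /eqP.
  by rewrite eqn_pmul2l ?(ltnW a1) // => /eqP a_1; rewrite -a_1 in a1.
(* The clique of [u]. Its size equals the degree of [u], as [u] itself replaces the neighbour
   [v]. *)
pose C := [set j | (j != v) && ((j == u) || e u j)].
have uC : u \in C by rewrite inE uv eqxx.
have clique i j : i \in C -> j \in C -> i != j -> e i j.
  rewrite !inE => /andP[iv /orP[/eqP->|ui]] /andP[jv /orP[/eqP->|uj]] ij //.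
  - by rewrite eqxx in ij.
  - by rewrite eC.
  by apply: (tr i u j) => //; rewrite eC.
have degC j : j \in C -> #|C| <= degree e j.
  move=> jC; have jv : j != v by move: jC; rewrite inE => /andP[].
  rewrite /degree (bigD1 v) //= eC dom // (cardsD1 j) jC leq_add2l -sum1_card big_mkcond /=.
  rewrite [leqRHS]big_mkcond /=; apply: leq_sum => k _; rewrite !inE.
  case: ifP => // /andP[kj kC]; have kC' : k \in C by rewrite inE.
  by move/andP: kC => [-> _]; rewrite clique // eq_sym.
have cardC : #|C| = degree e u.
  rewrite /degree (bigD1 v) //= eC dom // (cardsD1 u) uC; congr (_ + _).
  rewrite -sum1_card big_mkcond [RHS]big_mkcond /=; apply: eq_bigr => k _; rewrite !inE.
  have [->|ku] := eqVneq k u; first by rewrite ei /=; case: (_ != _).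
  by case: (k != v); case: (e u k).
have splitC : \sum_(i | i != v) c i = \sum_(i in C) c i + \sum_(i | (i != v) && (i \notin C)) c i.
  rewrite (bigID (mem C)) /=; congr (_ + _); apply: eq_bigl => i.
  by rewrite inE; case: (i != v).
have lowC : #|C| * (#|C|).-1 <= \sum_(i in C) c i.
  by rewrite -sum_nat_const; apply: leq_sum => i /degC; rewrite /c; lia.
(* [C] contributes at least [#|C| (#|C| - 1)] to a total of [a (a - 1)], while [#|C|] is at least
   [a]. *)
have [Ca out0] : #|C| = a /\ \sum_(i | (i != v) && (i \notin C)) c i = 0.
  move: sc lowC ua; rewrite splitC -cardC.
  move: (\sum_(i in C) _) (\sum_(i | (i != v) && _) _) #|C| => S S' k sSa lowS.
  rewrite leq_eqVlt => /orP[/eqP ak|ak].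
    have : a * a.-1 + a = a * a by rewrite -mulnSr prednK // ltnW.
    by move: lowS; rewrite -ak; move: sSa; move: (a * a) (a * a.-1) => ??; lia.
  have : a * a <= k * k.-1 by apply: leq_mul; [exact: ltnW|rewrite -ltnS prednK // (leq_trans _ ak)].
  by move: sSa lowS a1; move: (a * a) (k * k.-1) => ??; lia.
exists C; first by rewrite inE eqxx.
move=> x y; rewrite /cone_rel; have [->|xy] := eqVneq x y; first by rewrite ei.
have [exv|xv] := eqVneq x v; first by rewrite exv dom // eq_sym -exv.
have [->|yv] := eqVneq y v; first by rewrite eC dom.
(* Outside [C] the excess [c] is zero, so [v] is the only neighbour. *)
rewrite /=; have out i j : i != v -> j != v -> i \notin C -> e i j = false.
  move=> iv jv iC; apply/negP => eij.
  have : c i = 0.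
    by move/eqP: out0; rewrite sum_nat_eq0 => /forall_inP/(_ i); rewrite iv => /(_ iC)/eqP.
  by rewrite /c /degree (bigD1 v) //= (bigD1 j) //= eij eC dom.
have [xC|xC] := boolP (x \in C); last by rewrite out.
have [yC|yC] := boolP (y \in C); last by rewrite eC out.
by rewrite clique.
Qed.

(** * Isomorphism of cones and conclusion *)

Lemma cone_iso n (v v' : 'I_n) (C C' : {set 'I_n}) :
  v \notin C -> v' \notin C' -> #|C| = #|C'| -> graph_iso (cone_rel v C) (cone_rel v' C').
Proof.
move=> vC vC' eqC.
(* Listing the apex first, then the clique, then the rest lets the index alone tell the class of a
   vertex; the isomorphism preserves indices. *)
pose s (w : 'I_n) (D : {set 'I_n}) := w :: enum D ++ enum (~: (w |: D)).
have us w (D : {set 'I_n}) : w \notin D -> uniq (s w D).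
  move=> wD; rewrite /= cat_uniq !enum_uniq mem_cat !mem_enum (negbTE wD) !inE eqxx /= andbT.
  by apply/hasPn => i; rewrite !mem_enum !inE negb_or => /andP[].
have sT w (D : {set 'I_n}) i : i \in s w D.
  by rewrite inE mem_cat !mem_enum !inE negb_or; case: (i == w); case: (i \in D).
have ss w (D : {set 'I_n}) : w \notin D -> size (s w D) = n by move=> wD; apply: size_list (us _ _ wD) _.
have idxv w (D : {set 'I_n}) : index w (s w D) = 0 by rewrite /= eqxx.
have idxC w (D : {set 'I_n}) i : w \notin D -> (i \in D) = (0 < index i (s w D) <= #|D|).
  move=> wD; rewrite /=; case: (eqVneq w i) => [<-|wi]; first by rewrite (negbTE wD).
  rewrite index_cat mem_enum; case: (boolP (i \in D)) => iD.
    by rewrite ltnS cardE index_mem mem_enum iD.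
  by rewrite cardE; apply/esym/negbTE; rewrite -leqNgt /=; lia.
pose f (w w' : 'I_n) (D D' : {set 'I_n}) i := nth w' (s w' D') (index i (s w D)).
have lt_idx w (D : {set 'I_n}) i : w \notin D -> index i (s w D) < n by move=> wD; have := index_mem i (s w D); rewrite (ss _ _ wD) sT.
have fK w w' (D D' : {set 'I_n}) : w \notin D -> w' \notin D' -> cancel (f w w' D D') (f w' w D' D).
  move=> wD wD' i; rewrite /f index_uniq ?us ?ss ?lt_idx //.
  by rewrite nth_index.
have fidx i : index (f v v' C C' i) (s v' C') = index i (s v C).
  by rewrite /f index_uniq ?us ?ss ?lt_idx.
have fv i : (f v v' C C' i == v') = (i == v).
  apply/eqP/eqP => [fi|->]; last by rewrite /f idxv.
  by rewrite -(fK _ _ _ _ vC vC' i) fi /f idxv.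
have fC i : (f v v' C C' i \in C') = (i \in C).
  by rewrite (idxC v' C' _ vC') (idxC v C _ vC) fidx eqC.
exists (f v v' C C'); split; first by exists (f v' v C' C); apply: fK.
by move=> x y; rewrite /cone_rel (can_eq (fK _ _ _ _ vC vC')) !fv !fC.
Qed.

Lemma eq_gdist n (e e' : rel 'I_n) x y : e =2 e' -> gdist e x y = gdist e' x y.
Proof.
move=> ee'; apply: eq_find => k; elim: k x => //= k IH x; rewrite IH; congr (_ || _).
by apply: eq_existsb => z; rewrite ee' IH.
Qed.

Lemma Kpend_cone h n (v : 'I_n) : val v = 0 -> 0 < h ->
  Kpend h n =2 cone_rel v [set i : 'I_n | 0 < i < h].
Proof.
move=> v0 h0 x y; rewrite /Kpend /cone_rel !inE -!(inj_eq val_inj) /= v0; lia.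
Qed.

Lemma cone_spectrum_cluster n (e : rel 'I_n) v0 (Q : {set 'I_n}) :
  connected_simple e -> cone_spectrum e v0 Q -> v0 \notin Q -> 1 < #|Q| ->
  0 < #|~: (v0 |: Q)| -> exists v, cluster_cone e v.
Proof.
move=> ge sp vQ Q2 b0; have d2 x y : gdist e x y <= 2 by apply: (gdist_le2 _ _ ge sp).
have [[ei eC] _] := ge.
have [/existsP[x /existsP[y /eqP xy]]|] := boolP [exists x, exists y, gdist e x y == 2].
  have [v xv vy] := gdist_step ge xy; rewrite -gdist_eq1 // in xv; move/eqP: xv => xv.
  have dom w : w != v -> gdist e v w = 1 := P3_centre_dominates ge sp d2 xv vy xy.
  exists v; split=> // [w /dom /eqP|a b c av bv cv]; first by rewrite gdist_eq1.
  rewrite -!(gdist_eq1 _ _ ge) => /eqP ab /eqP bc ac.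
  have := link_P3_free ge sp vQ Q2 b0 dom av bv cv ab bc.
  by have := in_iota2 ge (d2 a c) ac; rewrite !inE => /orP[|->].
(* Without a pair at distance 2 the graph is complete, and its second moment [n (n - 1)] falls short
   by [6 a b + 3 b ^ 2 - 3 b], which is positive. *)
rewrite negb_exists => /forallP far; exfalso.
have d1 x y : gdist e x y ^ 2 = (x != y).
  have := far x; rewrite negb_exists => /forallP/(_ y) => nd.
  have [<-|xy] := eqVneq x y; first by rewrite gdistxx.
  by have := in_iota2 ge (d2 x y) xy; rewrite !inE (negbTE nd) orbF => /eqP ->.
have row x : \sum_y gdist e x y ^ 2 = n.-1.
  under eq_bigr => y _ do rewrite d1 eq_sym.
  rewrite -[n in RHS]card_ord -(cardC1 x) -sum1_card [RHS]big_mkcond.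
  by apply: eq_bigr => y _; rewrite !inE; case: eqP.
have := sum_gdist2_eq ge sp vQ => /=; have := card_cone_split vQ.
under eq_bigr => x _ do rewrite row.
rewrite sum_nat_const card_ord; move: Q2 b0; move: (#|Q|) (#|~: (v0 |: Q)|) => a b a1 b0 <-.
by rewrite -!mulnn /= add1n /=; have := leq_mul (ltnW a1) (leqnn b); have := leq_mul b0 (leqnn b); rewrite !mul1n; lia.
Qed.

Theorem theorem3p3 (h n : nat) :
  3 <= h -> h <= n - 1 ->
  forall (m : nat) (e : rel 'I_m),
    simple_graph e -> connected_graph e ->
    D_cospectral e (Kpend h n) ->
    graph_iso e (Kpend h n).
Proof.
move=> h3 hn m e se ce cosp.
(* A characteristic polynomial has size one more than the order of the matrix. *)
have mn : m = n.
  by have := congr1 (fun p : {poly algC} => size p) cosp; rewrite /= !size_char_poly => -[].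
subst m; have n4 : 3 < n by lia.
have ltn_n k : k < 4 -> k < n by move=> /leq_trans; apply.
pose v0 := Ordinal (ltn_n 0 isT); pose Q := [set i : 'I_n | 0 < i < h].
have Kc : Kpend h n =2 cone_rel v0 Q by apply: Kpend_cone => //; lia.
have vQ : v0 \notin Q by rewrite inE.
have Q2 : 1 < #|Q|.
  apply/card_gt1P; exists (Ordinal (ltn_n 1 isT)), (Ordinal (ltn_n 2 isT)).
  by rewrite !inE /=; split=> //; lia.
have b0 : 0 < #|~: (v0 |: Q)|.
  have lt_hn : h < n by lia.
  apply/card_gt0P; exists (Ordinal lt_hn); rewrite !inE -(inj_eq val_inj) /=; lia.
have ge : connected_simple e by [].
have sp : cone_spectrum e v0 Q.
  apply: cospectral_cone_spectrum => //; rewrite [LHS]cosp; congr char_poly.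
  by apply/matrixP => i j; rewrite !mxE (eq_gdist _ _ Kc).
have [v cc] := cone_spectrum_cluster ge sp vQ Q2 b0.
have [s1 s2] := degree_moments cc sp.
have [t1 t2] := degree_sums_cone vQ.
(* Both apices have degree [n - 1], so their terms cancel from the degree sums. *)
have dv : degree e v = degree (cone_rel v0 Q) v0.
  by apply: (@addIn 1); rewrite (degree_cone cc) (degree_cone (cone_cluster_cone v0 Q)).
have [C [vC Ca] eC] : exists2 C : {set 'I_n}, v \notin C /\ #|C| = #|Q| & e =2 cone_rel v C.
  apply: (cluster_cone_single_clique (b := #|~: (v0 |: Q)|) cc Q2); first exact: card_cone_split.
    by rewrite -t1; apply: (@addnI (degree e v)); rewrite {2}dv; move: s1;
      rewrite (bigD1 v) //= [RHS](bigD1 v0).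
  by rewrite -t2; apply: (@addnI (degree e v ^ 2)); rewrite {2}dv; move: s2;
    rewrite (bigD1 v) //= [RHS](bigD1 v0).
have [f [bf fE]] := cone_iso vC vQ Ca.
by exists f; split=> // x y; rewrite Kc fE eC.
Qed.
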